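(* The Haar basis of $L^p[0,1]$ with $1<p\le 2$ is an unconditional Hilbert-Schauder basis.
   Context: All Banach spaces are over the real scalars. The Haar basis of $L^p[0,1]$ is the Haar system $\{h_n\}_{n\in\mathbb{N}}$ on $[0,1]$: $h_1=1$ and, for $n=2^k+s$ with $k\ge 0$ and $1\le s\le 2^k$, $h_n=1$ on $[\frac{2s-2}{2^{k+1}},\frac{2s-1}{2^{k+1}})$, $h_n=-1$ on $[\frac{2s-1}{2^{k+1}},\frac{2s}{2^{k+1}})$, and $h_n=0$ elsewhere. For a separable Banach space $X$ with dual $X^*$, a Schauder basis $\{z_n\}$ of $X$ with biorthogonal functionals $\{z_n^*\}\subset X^*$ (written $\{z_n,z_n^*\}$) is called a Hilbert-Schauder basis (HS-basis) if there is a bounded linear operator $S:X\to X^*$ with $S(z_n)=z_n^*$ for all $n$. It is an unconditional Hilbert-Schauder basis if moreover the basis $\{z_n\}$ is unconditional.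
   Formalization: The Haar functions are scaled to norm 1 in L^p; for the unscaled h_n with values ±1, 0 the claim fails for every p, since ‖h_n‖ = 2^(-k/p) while the biorthogonal functional has norm 2^(k/p), so no bounded S with S(h_n) = h_n^* exists. *)

(* Defs.v *)
From HB Require Import structures.
From mathcomp Require Import all_boot all_order all_algebra.
From mathcomp Require Import all_classical all_reals all_analysis measurable_realfun ess_sup_inf.

Set Implicit Arguments.
Unset Strict Implicit.
Unset Printing Implicit Defensive.

Import Order.TTheory GRing.Theory Num.Theory.
Import numFieldNormedType.Exports.

Local Open Scope classical_set_scope.
Local Open Scope ring_scope.

Section dual.
Context (R : realType) (X : normedModType R).

Definition dual_pred : {pred X -> R^o} :=
  [pred f : X -> R^o | `[< linear f /\ continuous f >]].

Record dual := Dual { dual_fun :> X -> R^o; dualP : dual_fun \in dual_pred }.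

HB.instance Definition _ := [isSub for dual_fun].
HB.instance Definition _ := [Choice of dual by <:].

Lemma dual_submod_closed : submod_closed dual_pred.
Proof.
split.
  apply/asboolP; split; first by move=> a x y; rewrite /= scaler0 addr0.
  by move=> x; exact: cvg_cst.
move=> a f g /asboolP[lf cf] /asboolP[lg cg]; apply/asboolP; split.
  move=> b x y.
  rewrite -[LHS]/(a *: f (b *: x + y) + g (b *: x + y)).
  rewrite -[RHS]/(b *: (a *: f x + g x) + (a *: f y + g y)).
  by rewrite lf lg !scalerDr !scalerA (mulrC b) addrACA.
by move=> x; apply: (@cvgD _ _ _ _ _ (a \*: f) g);
  [apply: cvgZl_tmp; exact: cf|exact: cg].
Qed.

HB.instance Definition _ := GRing.isSubmodClosed.Build _ _ dual_pred
  dual_submod_closed.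
HB.instance Definition _ := [SubChoice_isSubLmodule of dual by <:].

Lemma dual_linear (f : dual) : linear f.
Proof. by case: f => f /= /asboolP[]. Qed.

HB.instance Definition _ (f : dual) :=
  GRing.isLinear.Build R X R^o *:%R f (@dual_linear f).

Lemma dual_continuous (f : dual) : continuous f.
Proof. by case: f => f /= /asboolP[]. Qed.

Lemma dualD (f g : dual) x : (f + g) x = f x + g x. Proof. by []. Qed.
Lemma dualZ (a : R) (f : dual) x : (a *: f) x = a *: f x. Proof. by []. Qed.

Definition dual_norm (f : dual) : R :=
  sup [set `|f x| | x in [set x : X | `|x| <= 1]].

Lemma dual_bounded (f : dual) : exists2 M, 0 < M & forall x, `|f x| <= M * `|x|.
Proof.
have /linear_bounded_continuous/linear_boundedP/pinfty_ex_gt0[M M0 fM] :=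
  @dual_continuous f.
by exists M.
Qed.

Lemma dual_norm_has_sup (f : dual) :
  has_sup [set `|f x| | x in [set x : X | `|x| <= 1]].
Proof.
split; first by exists `|f 0|, 0 => //=; rewrite normr0.
have [M M0 fM] := dual_bounded f.
exists M => _ [x /= x1 <-]; apply: (le_trans (fM x)).
by rewrite -[leRHS]mulr1 ler_wpM2l// ltW.
Qed.

Lemma le_dual_norm1 (f : dual) x : `|x| <= 1 -> `|f x| <= dual_norm f.
Proof.
by move=> x1; apply: ub_le_sup; [exact: (dual_norm_has_sup f).2|exists x].
Qed.

Lemma dual_norm_ge0 (f : dual) : 0 <= dual_norm f.
Proof. by apply: (le_trans _ (@le_dual_norm1 f 0 _)); rewrite ?normr0. Qed.

Lemma le_dual_norm (f : dual) x : `|f x| <= dual_norm f * `|x|.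
Proof.
have [->|x0] := eqVneq x 0; first by rewrite linear0 !normr0 mulr0.
have nx0 : 0 < `|x| by rewrite normr_gt0.
rewrite -ler_pdivrMr//.
have -> : `|f x| / `|x| = `|f (`|x|^-1 *: x)|.
  by rewrite linearZ normrZ gtr0_norm ?invr_gt0// mulrC.
by apply: le_dual_norm1; rewrite normrZ gtr0_norm ?invr_gt0// mulVf ?gt_eqF.
Qed.

Lemma dual_norm_le (f : dual) M :
  (forall x, `|x| <= 1 -> `|f x| <= M) -> dual_norm f <= M.
Proof.
move=> fM; apply: ge_sup; first exact: (dual_norm_has_sup f).1.
by move=> _ [x /= x1 <-]; exact: fM.
Qed.

Lemma dual_normD (f g : dual) : dual_norm (f + g) <= dual_norm f + dual_norm g.
Proof.
apply: dual_norm_le => x x1; rewrite dualD; apply: (le_trans (ler_normD _ _)).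
by rewrite lerD// le_dual_norm1.
Qed.

Lemma dual_normZ (a : R) (f : dual) : dual_norm (a *: f) = `|a| * dual_norm f.
Proof.
apply/eqP; rewrite eq_le; apply/andP; split.
  apply: dual_norm_le => x x1; rewrite dualZ normrZ.
  by rewrite ler_wpM2l// le_dual_norm1.
have [->|a0] := eqVneq a 0; first by rewrite normr0 mul0r dual_norm_ge0.
rewrite -ler_pdivlMl ?normr_gt0//; apply: dual_norm_le => x x1.
rewrite ler_pdivlMl ?normr_gt0// -normrZ -dualZ.
exact: le_dual_norm1.
Qed.

Lemma dual_norm_eq0 (f : dual) : dual_norm f = 0 -> f = 0.
Proof.
move=> f0; apply/val_inj/funext => x /=; apply/eqP; rewrite -normr_le0.
by rewrite (le_trans (le_dual_norm f x))// f0 mul0r.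
Qed.

HB.instance Definition _ := Lmodule_isNormed.Build R dual
  dual_normD dual_normZ dual_norm_eq0.

End dual.

Section bases.
Context (R : realType) (X : normedModType R).
Implicit Types (z : nat -> X) (zs : nat -> dual X).

Definition schauder_basis z :=
  forall x : X, exists! a : nat -> R, series (fun n => a n *: z n) @ \oo --> x.

(* Every expansion converges unconditionally: all its rearrangements converge
   to the same sum. *)
Definition unconditional_basis z :=
  schauder_basis z /\
  forall (x : X) (a : nat -> R), series (fun n => a n *: z n) @ \oo --> x ->
  forall s : nat -> nat, bijective s ->
    series (fun n => a (s n) *: z (s n)) @ \oo --> x.

Definition biorthogonal z zs := forall m n, zs m (z n) = (m == n)%:R.

Definition bounded_operator (Y : normedModType R) (S : {linear X -> Y}) :=
  exists C : R, forall x, `|S x| <= C * `|x|.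

(* Biorthogonality determines [zs], since the span of a Schauder basis is
   dense. *)
Definition HS_basis z :=
  schauder_basis z /\
  exists2 zs, biorthogonal z zs &
    exists2 S : {linear X -> dual X},
      bounded_operator S & forall n, S (z n) = zs n.

Definition unconditional_HS_basis z := HS_basis z /\ unconditional_basis z.

End bases.

Section Lspace_normed.
Context d (T : measurableType d) (R : realType).
Variables (mu : {measure set T -> \bar R}) (p : \bar R) (p1 : (1 <= p)%E).

Local Notation Lp := (LspaceType mu p1).
Local Notation Lfun := (Lfun mu p).

Lemma Lspace_measurable (u : Lp) : measurable_fun setT (u : T -> R).
Proof.
case: u => u cu /=.
have := @measurable_funPT _ _ T (measurableTypeR R) (repr u).
done.
Qed.

Lemma Lspace_Lfun (u : Lp) : (u : T -> R) \in Lfun.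
Proof.
rewrite inE; apply/andP; split; rewrite inE/=.
  exact: Lspace_measurable.
exact: Lebesgue_finite.
Qed.

Lemma ae_eq_Lnorm (f g : T -> R) :
  measurable_fun setT f -> measurable_fun setT g -> f = g %[ae mu] ->
  ('N[mu]_p[EFin \o f] = 'N[mu]_p[EFin \o g])%E.
Proof.
move=> mf mg fg; rewrite unlock /Lnorm; case: p p1 => [r _|_|//].
- congr (_ `^ _)%E; apply: ge0_ae_eq_integral => //.
  + apply: (@measurableT_comp _ _ _ _ _ _ (fun x : \bar R => x `^ r)%E).
      exact: measurable_poweR.
    by apply: measurableT_comp => //; exact/measurable_EFinP.
  + apply: (@measurableT_comp _ _ _ _ _ _ (fun x : \bar R => x `^ r)%E).
      exact: measurable_poweR.
    by apply: measurableT_comp => //; exact/measurable_EFinP.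
  + by move=> x _; exact: poweR_ge0.
  + by move=> x _; exact: poweR_ge0.
  + exact: (@ae_eq_comp _ _ _ mu setT _ _ (fun y : R => `|y%:E| `^ r)%E f g fg).
- case: ifPn => // mu0; apply: eq_ess_sup.
  have := @ae_eq_comp _ _ _ mu setT _ _ (fun y : R => `|y%:E|)%E f g fg.
  by apply: filterS => x /= ->.
Qed.

Definition ae_class (f : {mfun T >-> measurableTypeR R}) :
  {mfun_ mu, T >-> measurableTypeR R} := (\pi f)%qT.

Lemma ae_classE (f : {mfun T >-> measurableTypeR R}) :
  ae_class f = f %[ae mu].
Proof.
have /eqmodP/asboolP : repr (ae_class f) = f %[mod {mfun_ mu, T >-> measurableTypeR R}]%qT.
  by rewrite reprK.
done.
Qed.

Lemma Lfun_mfunR (f : T -> R) : f \in Lfun ->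
  (f : T -> measurableTypeR R) \in @mfun _ _ T (measurableTypeR R).
Proof. by move=> /sub_Lfun_mfun /set_mem mf; apply/mem_set. Qed.

Lemma Lspace_of_subproof (f : T -> R) (fL : f \in Lfun) :
  finite_norm mu p
    (ae_class (mfun_Sub (Lfun_mfunR fL)) : T -> measurableTypeR R).
Proof.
rewrite /finite_norm (@ae_eq_Lnorm _ f).
- by have /andP[_ /set_mem] := fL.
- exact: (@measurable_funPT _ _ T (measurableTypeR R) (repr (ae_class _))).
- by have /andP[/set_mem] := fL.
- exact: ae_classE.
Qed.

Definition Lspace_of (f : T -> R) (fL : f \in Lfun) : Lp :=
  LebesgueSpace.Pack
    (LebesgueSpace.Class (isFinLebesgue.Build d T R mu p p1 _ (Lspace_of_subproof fL))).

Lemma Lspace_ofE (f : T -> R) (fL : f \in Lfun) : Lspace_of fL = f %[ae mu].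
Proof. exact: ae_classE. Qed.

Lemma Lspace_eq (u v : Lp) : u = v %[ae mu] -> u = v.
Proof.
case: u v => [u [[uf]]] [v [[vf]]] /= uv.
have {uv} uv : u = v.
  by rewrite -[u]reprK -[v]reprK; apply/eqmodP/asboolP.
by subst v; rewrite (Prop_irrelevance uf vf).
Qed.

Lemma Lspace_of_eq (f : T -> R) (fL : f \in Lfun) (u : Lp) :
  f = u %[ae mu] -> Lspace_of fL = u.
Proof. by move=> fu; apply/Lspace_eq/(ae_eq_trans (Lspace_ofE fL)). Qed.

HB.instance Definition _ := gen_eqMixin Lp.
HB.instance Definition _ := gen_choiceMixin Lp.

Lemma Lfun_lin a (u v : Lp) : (fun x => a * u x + v x) \in Lfun.
Proof. exact: (Lfun_submod_closed mu p1).2 (Lspace_Lfun u) (Lspace_Lfun v). Qed.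

Lemma Lfun_cst0 : (fun=> 0) \in Lfun.
Proof. exact: (Lfun_submod_closed mu p1).1. Qed.

Lemma Lfun_add (u v : Lp) : (fun x => u x + v x) \in Lfun.
Proof. by have := Lfun_lin 1 u v; under eq_fun do rewrite mul1r. Qed.

Lemma Lfun_scal a (u : Lp) : (fun x => a * u x) \in Lfun.
Proof.
have := (Lfun_submod_closed mu p1).2 a _ _ (Lspace_Lfun u) Lfun_cst0.
by rewrite addr0.
Qed.

Lemma Lfun_opp (u : Lp) : (fun x => - u x) \in Lfun.
Proof. by have := Lfun_scal (-1) u; under eq_fun do rewrite mulN1r. Qed.

Let zero := Lspace_of Lfun_cst0.
Let opp u := Lspace_of (Lfun_opp u).
Let add u v := Lspace_of (Lfun_add u v).
Let scale a u := Lspace_of (Lfun_scal a u).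

Let zeroE : zero = (fun=> 0) %[ae mu]. Proof. exact: Lspace_ofE. Qed.
Let oppE u : opp u = (fun x => - u x) %[ae mu]. Proof. exact: Lspace_ofE. Qed.
Let addE u v : add u v = (fun x => u x + v x) %[ae mu].
Proof. exact: Lspace_ofE. Qed.
Let scaleE a u : scale a u = (fun x => a * u x) %[ae mu].
Proof. exact: Lspace_ofE. Qed.

Let addA : associative add.
Proof.
move=> u v w; apply: Lspace_eq; near=> x => _.
rewrite (near (addE u (add v w)))// (near (addE v w))//.
by rewrite (near (addE (add u v) w))// (near (addE u v))// addrA.
Unshelve. all: by end_near. Qed.

Let addC : commutative add.
Proof.
move=> u v; apply: Lspace_eq; near=> x => _.
by rewrite (near (addE u v))// (near (addE v u))// addrC.
Unshelve. all: by end_near. Qed.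

Let add0 : left_id zero add.
Proof.
move=> u; apply: Lspace_eq; near=> x => _.
by rewrite (near (addE zero u))// (near zeroE)// add0r.
Unshelve. all: by end_near. Qed.

Let addN : left_inverse zero opp add.
Proof.
move=> u; apply: Lspace_eq; near=> x => _.
by rewrite (near (addE (opp u) u))// (near (oppE u))// (near zeroE)// addNr.
Unshelve. all: by end_near. Qed.

HB.instance Definition _ := GRing.isZmodule.Build Lp addA addC add0 addN.

Let scaleA a b u : scale a (scale b u) = scale (a * b) u.
Proof.
apply: Lspace_eq; near=> x => _.
rewrite (near (scaleE a (scale b u)))// (near (scaleE b u))//.
by rewrite (near (scaleE (a * b) u))// mulrA.
Unshelve. all: by end_near. Qed.

Let scale1 : left_id 1 scale.
Proof.
move=> u; apply: Lspace_eq; near=> x => _.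
by rewrite (near (scaleE 1 u))// mul1r.
Unshelve. all: by end_near. Qed.

Let scaleDr : right_distributive scale +%R.
Proof.
move=> a u v; rewrite -[u + v]/(add u v) -[RHS]/(add (scale a u) (scale a v)).
apply: Lspace_eq; near=> x => _.
rewrite (near (scaleE a (add u v)))// (near (addE u v))//.
rewrite (near (addE (scale a u) (scale a v)))//.
by rewrite (near (scaleE a u))// (near (scaleE a v))// mulrDr.
Unshelve. all: by end_near. Qed.

Let scaleDl u : {morph scale^~ u : a b / a + b}.
Proof.
move=> a b; rewrite -[RHS]/(add (scale a u) (scale b u)).
apply: Lspace_eq; near=> x => _.
rewrite (near (scaleE (a + b) u))// (near (addE (scale a u) (scale b u)))//.
by rewrite (near (scaleE a u))// (near (scaleE b u))// mulrDl.
Unshelve. all: by end_near. Qed.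

HB.instance Definition _ := GRing.Zmodule_isLmodule.Build R Lp
  scaleA scale1 scaleDr scaleDl.

Lemma Lspace_0E : (0 : Lp) = (fun=> 0) %[ae mu].
Proof. exact: zeroE. Qed.
Lemma Lspace_addE (u v : Lp) : u + v = (fun x => u x + v x) %[ae mu].
Proof. exact: addE. Qed.
Lemma Lspace_oppE (u : Lp) : - u = (fun x => - u x) %[ae mu].
Proof. exact: oppE. Qed.
Lemma Lspace_scaleE a (u : Lp) : a *: u = (fun x => a * u x) %[ae mu].
Proof. exact: scaleE. Qed.

Definition Lspace_norm (u : Lp) : R := fine ('N[mu]_p[EFin \o u])%E.

Lemma Lspace_normE (u : Lp) : (Lspace_norm u)%:E = ('N[mu]_p[EFin \o u])%E.
Proof.
rewrite fineK// fin_numElt (lt_le_trans ltNy0) ?Lnorm_ge0//=.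
exact: Lebesgue_finite.
Qed.

Lemma Lspace_norm_of (f : T -> R) (fL : f \in Lfun) :
  Lspace_norm (Lspace_of fL) = fine ('N[mu]_p[EFin \o f])%E.
Proof.
congr fine; apply: ae_eq_Lnorm; [exact: Lspace_measurable| |exact: Lspace_ofE].
by have /andP[/set_mem] := fL.
Qed.

Lemma Lspace_normD (u v : Lp) :
  Lspace_norm (u + v) <= Lspace_norm u + Lspace_norm v.
Proof.
rewrite -lee_fin EFinD [(Lspace_norm u)%:E]Lspace_normE.
rewrite [(Lspace_norm v)%:E]Lspace_normE.
have muv := measurable_funD (@Lspace_measurable u) (@Lspace_measurable v).
rewrite Lspace_normE (ae_eq_Lnorm (@Lspace_measurable _) muv (Lspace_addE u v)).
by apply: eminkowski => //; exact: Lspace_measurable.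
Qed.

Lemma Lspace_normZ a (u : Lp) : Lspace_norm (a *: u) = `|a| * Lspace_norm u.
Proof.
apply: EFin_inj; rewrite Lspace_normE EFinM Lspace_normE.
have mau := measurable_funM (measurable_cst a) (@Lspace_measurable u).
rewrite (ae_eq_Lnorm (@Lspace_measurable _) mau (Lspace_scaleE a u)).
exact: (LnormZ (Lfun_Sub p1 (Lspace_Lfun u)) a).
Qed.

Lemma Lspace_norm_eq0 (u : Lp) : Lspace_norm u = 0 -> u = 0.
Proof.
move=> u0; apply: Lspace_eq.
have := @fine_Lnormr_eq0 _ _ _ _ _ p1 (Lfun_Sub p1 (Lspace_Lfun u)) u0.
move=> /ae_eq_trans; apply; apply: ae_eq_sym; exact: Lspace_0E.
Qed.

HB.instance Definition _ := Lmodule_isNormed.Build R Lp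
  Lspace_normD Lspace_normZ Lspace_norm_eq0.

End Lspace_normed.

Section haar.
Context (R : realType).

(* [haar m] is h_{m+1}: for m > 0, m + 1 = 2 ^ k + s with 1 <= s <= 2 ^ k.
   Values outside [0, 1] are irrelevant for [leb01]. *)
Definition haar (m : nat) : R -> R :=
  if m is 0%N then cst 1 else
  let k := trunc_log 2 m in
  let s := (m.+1 - 2 ^ k)%N in
  \1_(`[(2 * s - 2)%:R / 2 ^+ k.+1, (2 * s - 1)%:R / 2 ^+ k.+1[)
  \- \1_(`[(2 * s - 1)%:R / 2 ^+ k.+1, (2 * s)%:R / 2 ^+ k.+1[).

Lemma haar_index (m : nat) : (0 < m)%N ->
  let k := trunc_log 2 m in let s := (m.+1 - 2 ^ k)%N in
  (m.+1 = 2 ^ k + s /\ 1 <= s <= 2 ^ k)%N.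
Proof.
move=> m0 k s.
have /andP[km mk] : (2 ^ k <= m < 2 ^ k.+1)%N by exact: trunc_log_bounds.
rewrite /s subnKC ?(leq_trans km)//; split=> //.
by rewrite subn_gt0 ltnS km leq_subLR addnn -mul2n -expnS.
Qed.

Lemma measurable_haar m : measurable_fun setT (haar m).
Proof.
case: m => [|m]; first exact: measurable_cst.
by apply: measurable_funB; apply: measurable_indic; exact: measurable_itv.
Qed.

Lemma normr_haar_le1 m x : `|haar m x| <= 1.
Proof.
case: m => [|m]; first by rewrite /= normr1.
rewrite /= !indicE.
by do 2 case: (_ \in _); rewrite ?subrr ?subr0 ?sub0r ?normrN ?normr0 ?normr1.
Qed.

(* Lebesgue measure on R restricted to [0, 1]: functions on R modulo equality
   almost everywhere for [leb01] are functions on [0, 1] modulo equality almost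
   everywhere. *)
Definition leb01 : {measure set (measurableTypeR R) -> \bar R} :=
  mrestr lebesgue_measure (measurable_itv `[0, 1]).

Variables (p : R) (p1 : (1 <= p%:E)%E).

Lemma haar_Lfun m : (haar m : measurableTypeR R -> R) \in Lfun leb01 p%:E.
Proof.
have mh := @measurable_haar m.
apply/andP; split; apply/mem_set; first exact: mh.
rewrite /= /finite_norm unlock poweR_lty//.
have p0 : 0 <= p by rewrite (le_trans ler01)// -lee_fin.
apply: (@le_lt_trans _ _ (\int[leb01]_x (cst 1%E x))%E).
  apply: ge0_le_integral => //.
  - by move=> x _; exact: poweR_ge0.
  - apply: (@measurableT_comp _ _ _ _ _ _ (fun x : \bar R => x `^ p)%E).
      exact: measurable_poweR.
    by apply: measurableT_comp => //; exact/measurable_EFinP.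
  - move=> x _ /=; rewrite lee_fin.
    rewrite (le_trans (ge0_ler_powR p0 _ _ (normr_haar_le1 m x)))// ?nnegrE//.
    by rewrite powR1.
rewrite integral_cst// mul1e /leb01 /= /mrestr setTI lebesgue_measure_itv/=.
by rewrite lte_fin ltr01 ltry.
Qed.

Definition haar_Lp (m : nat) : LspaceType leb01 p1 := Lspace_of p1 (haar_Lfun m).

(* The Haar basis of L^p is the Haar system scaled to norm 1 in L^p.  For the
   unscaled functions the functional biorthogonal to h_n, n = 2 ^ k + s, is
   2 ^ k * h_n, of norm 2 ^ (k / p), while h_n has norm 2 ^ (- k / p): no bounded
   operator maps each h_n to its functional.  The scaling changes neither the
   Schauder property nor unconditionality. *)
Definition haar_basis (m : nat) : LspaceType leb01 p1 :=
  `|haar_Lp m|^-1 *: haar_Lp m.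

End haar.

Lemma lee1_fin (R : realType) (p : R) : 1 < p -> (1 <= p%:E)%E.
Proof. by rewrite lee_fin => /ltW. Qed.

(* Main.v *)
From HB Require Import structures.
Require Import Defs.
From mathcomp Require Import all_boot all_order all_algebra.
From mathcomp Require Import all_classical all_reals all_analysis.
From mathcomp Require Import measurable_realfun.
From mathcomp Require Import ring lra zify.

(* A normalized sequence with dense span whose partial sums have nondecreasing
   norms is a Schauder basis; it is an unconditional one as soon as the norm of
   a subsum is controlled by that of the whole sum, and it is an HS-basis as
   soon as the coefficients of a vector [x] satisfy [sum a_n(x)^2 <= C |x|^2],
   since [S x y = sum a_n(x) a_n(y)] is then bounded.

   For the Haar system, adding the term [a h_n] to the partial sum replaces its
   constant value [f] on the support of [h_n] by [f + a] and [f - a] with equal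
   probabilities, so each estimate is a two-point inequality.  Convexity of
   [|t|^p] gives the monotonicity.  Its uniform convexity on [[-2, 2]], where the
   second derivative is bounded below because [p <= 2], gives the increment
   [c a_n^2 <= |S_n+1|^p - |S_n|^p] when [|S_n+1| <= 1], hence the square
   summability.  Subsums are controlled by Burkholder's method: with [u] the
   subsum and [v] the sum of the other terms, the expectation of Burkholder's
   function of [(u, v)], concave in each variable, does not increase with [n],
   and this function dominates a multiple of [|u|^p - C |u + v|^p]. *)

Set Implicit Arguments.
Unset Strict Implicit.
Unset Printing Implicit Defensive.

Import Order.TTheory GRing.Theory Num.Theory.
Import numFieldNormedType.Exports.

Local Open Scope classical_set_scope.
Local Open Scope ring_scope.

(** * Two-point inequalities *)

Section two_powers.
Context (R : realType).
Implicit Types a b r s x y : R.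

(** The one-variable functions below, namely the branches of Burkholder's function, -t^p and c t^2 -
    t^p, are all combinations of two powers of t > 0, so a single mean value theorem serves them. *)
Lemma two_powers_MVT a r b s x y : 0 < x -> x < y ->
  exists2 c, x < c < y &
    (a * y `^ r + b * y `^ s) - (a * x `^ r + b * x `^ s) =
    (a * r * c `^ (r - 1) + b * s * c `^ (s - 1)) * (y - x).
Proof.
move=> x0 xy.
pose f (t : R) := a * t `^ r + b * t `^ s.
pose df (t : R) := a * r * t `^ (r - 1) + b * s * t `^ (s - 1).
have fdf (t : R) : 0 < t -> is_derive t 1 f (df t).
  move=> t0.
  have -> : f = (a \*: (fun t : R => t `^ r)) + (b \*: (fun t : R => t `^ s)) by [].

  rewrite /df -!mulrA.
  apply: is_deriveD; apply: is_deriveZ; exact: is_derive1_powR.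
have [||c] := @MVT R f df x y xy.
- by move=> t; rewrite in_itv/= => /andP[xt _]; apply: fdf; exact: lt_trans xt.
- apply: derivable_within_continuous => t; rewrite in_itv/= => /andP[xt _].
  by have [] := fdf t (lt_le_trans x0 xt).
by rewrite in_itv/= => cxy fE; exists c.
Qed.

Lemma two_powers_le a r b s x y : 0 < x -> x <= y ->
  (forall c, x < c < y -> a * r * c `^ (r - 1) + b * s * c `^ (s - 1) <= 0) ->
  a * y `^ r + b * y `^ s <= a * x `^ r + b * x `^ s.
Proof.
move=> x0; rewrite le_eqVlt => /predU1P[->//|xy] df.
have [c cxy E] := two_powers_MVT a r b s x0 xy.
by rewrite -subr_le0 E pmulr_lle0 ?subr_gt0// df.
Qed.

(** The mean value point lies between [x] and [y], so a derivative that is nonincreasing there keeps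
    the graph below its tangent at [x], on whichever side [y] lies. *)
Lemma two_powers_tangent a r b s x y : 0 < x -> 0 < y ->
  (forall t w, Num.min x y <= t -> t <= w -> w <= Num.max x y ->
     a * r * w `^ (r - 1) + b * s * w `^ (s - 1) <=
     a * r * t `^ (r - 1) + b * s * t `^ (s - 1)) ->
  a * y `^ r + b * y `^ s <= a * x `^ r + b * x `^ s +
    (a * r * x `^ (r - 1) + b * s * x `^ (s - 1)) * (y - x).
Proof.
move=> x0 y0 df; rewrite -lerBlDl.
have [xy|yx|->] := ltgtP x y; last by rewrite !subrr mulr0.
- have [c /andP[xc cy] ->] := two_powers_MVT a r b s x0 xy.
  rewrite ler_wpM2r ?subr_ge0 ?(ltW xy)// df ?(ltW xc)//.
    by rewrite ge_min lexx.
  by rewrite le_max (ltW cy) orbT.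
- have [c /andP[yc cx]] := two_powers_MVT a r b s y0 yx.
  move/(congr1 -%R); rewrite opprB => ->; rewrite -mulrN opprB.
  rewrite ler_wnM2r ?subr_le0 ?(ltW yx)// df ?(ltW cx)//.
    by rewrite ge_min (ltW yc) orbT.
  by rewrite le_max lexx.
Qed.

End two_powers.

(** * Burkholder's function and the convexity of |t|^p *)

Section burkholder.
Context (R : realType) (p : R) (p_gt1 : 1 < p) (p_le2 : p <= 2).
Implicit Types u v w x y m : R.

(** In the coordinates x = u + v, y = u - v, where |x| + |y| = 2 max(|u|, |v|), this is a positive
    multiple of Burkholder's (|y| - |x| / (p - 1)) (|x| + |y|)^(p - 1). *)
Definition burkholder u v : R :=
  let m := Num.max `|u| `|v| in (p - 2) * m `^ p - p * (u * v) * m `^ (p - 2).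

Let p0 : 0 < p. Proof. exact: lt_trans p_gt1. Qed.
Let p1 : 0 < p - 1. Proof. by rewrite subr_gt0. Qed.

Lemma burkholderN u v : burkholder (- u) (- v) = burkholder u v.
Proof. by rewrite /burkholder !normrN mulrNN. Qed.

Lemma burkholderC u v : burkholder u v = burkholder v u.
Proof. by rewrite /burkholder maxC (mulrC u). Qed.

Let powM1 m : 0 < m -> m `^ (p - 1) = m * m `^ (p - 2).
Proof.
by move=> m0; rewrite -(@mulr_powRB1 _ _ (p - 1)) ?ltW//; congr (_ * _ `^ _); ring.
Qed.

Let powM m : 0 <= m -> m `^ p = m * m `^ (p - 1).
Proof. by move=> m0; rewrite mulr_powRB1. Qed.

(** For fixed [u >= 0] there are three branches in [v]: this affine one and, by symmetry, two outer
    ones that are sums of two powers of |v|. Concavity in [v] is checked on each branch and where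
    they meet. *)
Lemma burkholder_mid u v : `|v| <= u ->
  burkholder u v = (p - 2) * u `^ p - p * v * u `^ (p - 1).
Proof.
move=> vu; have u0 : 0 <= u by rewrite (le_trans _ vu).
rewrite /burkholder (ger0_norm u0) max_l//.
move: u0; rewrite le_eqVlt => /predU1P[u0|u0].
  have v0 : v = 0 by apply/eqP; rewrite -normr_le0 u0.
  by rewrite v0; ring.
by rewrite powM1//; ring.
Qed.

Lemma burkholder_right u v : 0 <= u -> u <= v ->
  burkholder u v = (p - 2) * v `^ p + (- (p * u)) * v `^ (p - 1).
Proof.
move=> u0 uv; rewrite burkholderC burkholder_mid; first by ring.
by rewrite ger0_norm.
Qed.

Lemma burkholder_left u v : 0 <= u -> u <= v ->
  burkholder u (- v) = (p - 2) * v `^ p + (p * u) * v `^ (p - 1).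
Proof.
move=> u0 uv; rewrite -burkholderN opprK burkholderC burkholder_mid; first by ring.
by rewrite normrN ger0_norm.
Qed.

(** The second derivative at [c] is -(2 - p) (p - 1) c^(p - 3) (p c + b), and p c + b >= 0 because
    [c] exceeds [u]. The right branch has b = -p u, the left one b = p u. *)
Lemma branch_slope_le (u b x y : R) : 0 < u -> - (p * u) <= b -> u <= x -> x <= y ->
  (p - 2) * p * y `^ (p - 1) + b * (p - 1) * y `^ (p - 1 - 1) <=
  (p - 2) * p * x `^ (p - 1) + b * (p - 1) * x `^ (p - 1 - 1).
Proof.
move=> u0 bu ux xy; have x0 := lt_le_trans u0 ux.
apply: two_powers_le => // c /andP[xc _].
have c0 := lt_trans x0 xc.
have -> : c `^ (p - 1 - 1) = c * c `^ (p - 1 - 1 - 1).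
  rewrite -{2}[c]powRr1 ?ltW// -powRD ?(gt_eqF c0) ?implybT//.
  by congr (_ `^ _); ring.
have Q0 : 0 <= c `^ (p - 1 - 1 - 1) by exact: powR_ge0.
set Q := c `^ _ in Q0 *.
have -> : (p - 2) * p * (p - 1) * (c * Q) + b * (p - 1) * (p - 1 - 1) * Q =
  - ((2 - p) * (p - 1) * Q * (p * c + b)) by ring.
rewrite oppr_le0 mulr_ge0//.
  by rewrite mulr_ge0 ?mulr_ge0 ?(ltW p1)// subr_ge0.
have : p * u <= p * c by rewrite ler_pM2l// ltW// (le_lt_trans ux).
by lra.
Qed.

Lemma branch_tangent (u b x y : R) : 0 < u -> - (p * u) <= b -> u <= x -> u <= y ->
  (p - 2) * y `^ p + b * y `^ (p - 1) <= (p - 2) * x `^ p + b * x `^ (p - 1) +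
   ((p - 2) * p * x `^ (p - 1) + b * (p - 1) * x `^ (p - 1 - 1)) * (y - x).
Proof.
move=> u0 bu ux uy; have [x0 y0] := (lt_le_trans u0 ux, lt_le_trans u0 uy).
apply: two_powers_tangent => // t w ut tw _; apply: (branch_slope_le u0) => //.
by rewrite (le_trans _ ut)// le_min ux.
Qed.

(** At [v = u] the right branch has the slope of the affine one, so the two are glued smoothly. *)
Let slope_right u : 0 < u ->
  (p - 2) * p * u `^ (p - 1) + (- (p * u)) * (p - 1) * u `^ (p - 1 - 1) =
  - (p * u `^ (p - 1)).
Proof.
move=> u0; rewrite (_ : p - 1 - 1 = p - 2); last by ring.
by rewrite powM1//; ring.
Qed.

Let slope_left u : 0 < u ->
  (p - 2) * p * u `^ (p - 1) + (p * u) * (p - 1) * u `^ (p - 1 - 1) =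
  p * (2 * p - 3) * u `^ (p - 1).
Proof.
move=> u0; rewrite (_ : p - 1 - 1 = p - 2); last by ring.
by rewrite powM1//; ring.
Qed.

Let pow_ge0 m (r : R) : 0 <= m `^ r. Proof. exact: powR_ge0. Qed.

(** In the variable -v the affine branch has slope p u^(p - 1); as 2 p - 3 <= 1, the left branch
    starts with at most that slope, so the kink at [v = - u] is concave. *)
Let slope_left_le u : p * (2 * p - 3) * u `^ (p - 1) <= p * u `^ (p - 1).
Proof.
rewrite ler_wpM2r ?pow_ge0// ler_piMr ?(ltW p0)//; move: p_le2; lra.
Qed.

(** Outside the affine branch, the tangent to the outer branch at |v| = u bounds it, and its slope
    in |v| is at most that of the line. *)
Lemma burkholder_le_line u v : 0 < u ->
  burkholder u v <= (p - 2) * u `^ p - p * v * u `^ (p - 1).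
Proof.
move=> u0; have pu0 : 0 <= p * u by rewrite mulr_ge0 ?(ltW p0) ?(ltW u0).
have [vu|uv] := leP `|v| u; first by rewrite burkholder_mid.
move: uv; rewrite ltr_normr => /orP[|] /ltW uv.
- rewrite burkholder_right// ?(ltW u0)//.
  apply: (le_trans (branch_tangent u0 (lexx _) (lexx u) uv)).
  by rewrite slope_right// (powM (ltW u0)); lra.
- rewrite -[v]opprK burkholder_left// ?(ltW u0)//.
  have bu : - (p * u) <= p * u by lra.
  apply: (le_trans (branch_tangent u0 bu (lexx u) uv)).
  rewrite slope_left// (powM (ltW u0)).
  have := slope_left_le u; rewrite -subr_ge0 => h1.
  have := mulr_ge0 h1 (_ : 0 <= - v - u); rewrite subr_ge0 => /(_ uv).
  by lra.
Qed.

(** On the affine branch the line itself serves. On an outer branch the tangent at [v] serves;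
    beyond the gluing point it still dominates the line of [burkholder_le_line], being above it at
    that point and having the smaller slope in the outward direction. *)
Lemma burkholder_supergradient_gt0 u v : 0 < u ->
  exists D, forall w, burkholder u w <= burkholder u v + D * (w - v).
Proof.
move=> u0; have pu0 : 0 <= p * u by rewrite mulr_ge0 ?(ltW p0) ?(ltW u0).
have bu : - (p * u) <= p * u by lra.
have [vu|uv] := leP `|v| u.
  exists (- (p * u `^ (p - 1))) => w.
  by rewrite (le_trans (burkholder_le_line w u0))// burkholder_mid//; lra.
move: uv; rewrite ltr_normr => /orP[|] /ltW uv.
- eexists => w; rewrite (burkholder_right (ltW u0) uv).
  have [uw|wu] := leP u w.
    rewrite burkholder_right// ?(ltW u0)//.
    exact: (branch_tangent u0 (lexx _) uv uw).
  apply: (le_trans (burkholder_le_line w u0)).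
  have tu := branch_tangent u0 (lexx _) uv (lexx u).
  have := branch_slope_le u0 (lexx _) (lexx u) uv.
  move: tu; rewrite slope_right//.
  set D := _ + - (p * u) * _ * _ => tu.
  rewrite -subr_ge0 => h1.
  have := mulr_ge0 h1 (_ : 0 <= u - w); rewrite subr_ge0 => /(_ (ltW wu)).
  by move: tu; rewrite (powM (ltW u0)); lra.
- set D := (p - 2) * p * (- v) `^ (p - 1) + (p * u) * (p - 1) * (- v) `^ (p - 1 - 1).
  exists (- D) => w.
  have -> : - D * (w - v) = D * (- w - - v) by ring.
  rewrite -{1}[v]opprK (burkholder_left (ltW u0) uv).
  have [uw|wu] := leP u (- w).
    rewrite -{1}[w]opprK burkholder_left// ?(ltW u0)//.
    exact: (branch_tangent u0 bu uv uw).
  apply: (le_trans (burkholder_le_line w u0)).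
  have tu := branch_tangent u0 bu uv (lexx u).
  have := le_trans (branch_slope_le u0 bu (lexx u) uv) _.
  move=> /(_ (p * u `^ (p - 1))); rewrite slope_left// slope_left_le => /(_ isT).
  move: tu; rewrite -/D => tu.
  rewrite -subr_ge0 => h1.
  have := mulr_ge0 h1 (_ : 0 <= u + w); rewrite -lerBlDr sub0r => /(_ (ltW wu)).
  by move: tu; rewrite (powM (ltW u0)); lra.
Qed.

Lemma normr_powR_tangent v : exists D, forall w,
  `|v| `^ p + D * (w - v) <= `|w| `^ p.
Proof.
wlog v0 : v / 0 <= v.
  move=> h; have [/h//|/ltW v0] := leP 0 v.
  have [|D Dw] := h (- v); first by rewrite oppr_ge0.
  by exists (- D) => w; have := Dw (- w); rewrite !normrN; lra.
have [->|vn0] := eqVneq v 0.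
  by exists 0 => w; rewrite mul0r addr0 normr0 powR0 ?gt_eqF.
have {v0 vn0} v0 : 0 < v by rewrite lt_neqAle eq_sym vn0.
have tg w : 0 < w -> v `^ p + p * v `^ (p - 1) * (w - v) <= w `^ p.
  move=> w0.
  suff : -1 * w `^ p + 0 * w `^ 0 <= -1 * v `^ p + 0 * v `^ 0 +
      (-1 * p * v `^ (p - 1) + 0 * 0 * v `^ (0 - 1)) * (w - v) by lra.
  apply: two_powers_tangent => // x y mx xy _.
  rewrite !mul0r !addr0 !mulN1r !mulNr lerN2.
  have x0 : 0 < x by rewrite (lt_le_trans _ mx)// lt_min v0.
  by rewrite ler_pM2l// ge0_ler_powR ?(ltW p1)// nnegrE ltW// (lt_le_trans x0).
exists (p * v `^ (p - 1)) => w; rewrite (gtr0_norm v0).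
have P0 : 0 <= p * v `^ (p - 1) by rewrite mulr_ge0 ?(ltW p0) ?pow_ge0.
have [w0|w0|->] := ltgtP w 0.
(* The tangent has nonnegative slope, so it is at least as high at [- w] as at [w]. *)
- rewrite ltr0_norm//; apply: le_trans (tg _ _); last by rewrite oppr_gt0.
  by rewrite lerD2l ler_wpM2l//; lra.
- by rewrite gtr0_norm// tg.
- rewrite normr0 powR0 ?gt_eqF// (powM (ltW v0)).
  have := mulr_ge0 (ltW v0) (pow_ge0 v (p - 1)) => h.
  by have := mulr_ge0 (ltW p1) h; lra.
Qed.

Lemma burkholder_supergradient u v :
  exists D, forall w, burkholder u w <= burkholder u v + D * (w - v).
Proof.
have [u0|u0|->] := ltgtP u 0; last 1 first.
(* For [u = 0] the function of [v] is (p - 2) |v|^p, with p - 2 <= 0. *)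
- have [D Dw] := normr_powR_tangent v.
  exists ((p - 2) * D) => w; rewrite /burkholder !normr0 !max_r//.
  have : 0 <= 2 - p by rewrite subr_ge0.
  move/mulr_ge0 => /(_ (`|w| `^ p - (`|v| `^ p + D * (w - v)))).
  by rewrite subr_ge0 => /(_ (Dw w)); lra.
- have [|D Dw] := @burkholder_supergradient_gt0 (- u) (- v).
    by rewrite oppr_gt0.
  exists (- D) => w; have := Dw (- w); rewrite !burkholderN.
  by move=> /le_trans; apply; lra.
- exact: burkholder_supergradient_gt0.
Qed.

(** This is the form in which concavity meets a Haar step, which moves one variable by [h] or [- h]
    with equal weights and fixes the other. *)
Lemma burkholder_midpointr u v h :
  burkholder u (v + h) + burkholder u (v - h) <= 2 * burkholder u v.
Proof.
have [D Dw] := burkholder_supergradient u v.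
by have := Dw (v + h); have := Dw (v - h); lra.
Qed.

Lemma burkholder_midpointl u v h :
  burkholder (u + h) v + burkholder (u - h) v <= 2 * burkholder u v.
Proof. by rewrite !(burkholderC _ v) burkholder_midpointr. Qed.

Lemma burkholder0r u : burkholder u 0 <= 0.
Proof.
rewrite /burkholder mulr0 mulr0 mul0r subr0 mulr_le0_ge0//.
by rewrite subr_le0.
Qed.

Lemma burkholder0l v : burkholder 0 v <= 0.
Proof. by rewrite burkholderC burkholder0r. Qed.

(** When |v| <= u, the left side minus Burkholder's function is u^(p - 1) (p (u + v) - (p - 1) u).
    Either this is nonpositive, or u <= p / (p - 1) |u + v| and the first term is absorbed by the
    multiple of |u + v|^p. *)
Lemma burkholder_majorization : exists2 C : R, 0 < C & forall u v,
  (p - 1) * `|u| `^ p <= burkholder u v + C * `|u + v| `^ p.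
Proof.
(* With s = |u + v|, this gives p s u^(p - 1) <= C s^p as soon as u <= p / (p - 1) s. *)
pose C := p * (p / (p - 1)) `^ (p - 1).
have C0 : 0 < C by rewrite mulr_gt0// powR_gt0// divr_gt0.
exists C => // u v.
wlog vu : u v / `|v| <= `|u|.
  move=> h; have [/h//|/ltW uv] := leP `|v| `|u|.
  have := h v u uv; rewrite burkholderC (addrC v); apply: le_trans.
  by rewrite ler_pM2l// ge0_ler_powR ?(ltW p0).
wlog u0 : u v vu / 0 <= u.
  move=> h; have [/h->//|/ltW u0] := leP 0 u.
  have := h (- u) (- v); rewrite !normrN burkholderN -opprD normrN; apply=> //.
  by rewrite oppr_ge0.
rewrite (ger0_norm u0) in vu *; rewrite burkholder_mid//.
have [->|un0] := eqVneq u 0.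
  rewrite powR0 ?gt_eqF// !mulr0 powR0 ?gt_eqF// mulr0 !subr0 !add0r.
  by rewrite mulr_ge0// ltW.
have {un0} {}u0 : 0 < u by rewrite lt_neqAle eq_sym un0.
have C1 : 0 <= C * `|u + v| `^ p by rewrite mulr_ge0// ltW.
have uv := ler_norm (u + v).
rewrite (powM (ltW u0)).
have [s|s] := leP (p * `|u + v|) ((p - 1) * u).
  have : p * (u + v) <= (p - 1) * u by rewrite (le_trans _ s)// ler_pM2l.
  rewrite -subr_ge0 => h; have := mulr_ge0 h (pow_ge0 u (p - 1)).
  by move: C1; lra.
have s0 : 0 <= `|u + v| by [].
have us : u <= p / (p - 1) * `|u + v|.
  by rewrite mulrAC ler_pdivlMr// mulrC ltW.
have : C * `|u + v| `^ p >= p * `|u + v| * u `^ (p - 1).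
  rewrite /C (powM s0) -!mulrA ler_pM2l// mulrCA ler_wpM2l//.
  rewrite -powRM//; last by rewrite divr_ge0// ltW.
  by rewrite ge0_ler_powR ?(ltW p1)// nnegrE ?(ltW u0)// (le_trans _ us)// ltW.
have : 0 <= p * (`|u + v| - (u + v)) * u `^ (p - 1).
  by rewrite mulr_ge0// mulr_ge0 ?(ltW p0)// subr_ge0.
have : 0 <= (p - 1) * (u * u `^ (p - 1)).
  by rewrite mulr_ge0 ?(ltW p1)// mulr_ge0// ltW.
by lra.
Qed.

(* On [[-2, 2]] the second derivative of [`|t| `^ p] is at least
   [p * (p - 1) * 2 `^ (p - 2)]. *)
Lemma normr_powR_uniform_convexity : exists2 c : R, 0 < c <= 1 & forall x y,
  `|x + y| <= 2 -> `|x - y| <= 2 ->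
  `|x| `^ p + c * y ^+ 2 <= (`|x + y| `^ p + `|x - y| `^ p) / 2.
Proof.
have P0 : 0 < (2 : R) `^ (p - 2) by rewrite powR_gt0.
have P1 : (2 : R) `^ (p - 2) <= 1.
  by rewrite -[leRHS](powRr0 2) ler_powR ?ler1n// subr_le0.
set P := _ `^ _ in P0 P1.
have P_le t : 0 < t -> t <= 2 -> P <= t `^ (p - 2).
  move=> t0 t2; rewrite /P -[p - 2]opprB 2!powRN lef_pV2 ?posrE ?powR_gt0//.
  by rewrite ge0_ler_powR// ?subr_ge0// nnegrE ltW.
have P_sqr t : 0 < t -> t <= 2 -> P * t ^+ 2 <= t `^ p.
  move=> t0 t2; rewrite (powM (ltW t0)) powM1// mulrA -expr2 mulrC.
  by rewrite ler_wpM2l ?sqr_ge0// P_le.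
(* Half the lower bound for the second derivative on [-2, 2], as in Taylor's formula. *)
pose c := p * (p - 1) * P / 2.
have c0 : 0 < c by rewrite divr_gt0// !mulr_gt0.
have c1 : c <= (p - 1) * P.
  have : 0 <= (2 - p) * ((p - 1) * P) 
    by rewrite mulr_ge0 ?subr_ge0// mulr_ge0 ?(ltW p1) ?(ltW P0).
  by rewrite /c; lra.
(* The tangent inequality at [x] with a quadratic gain. Averaging it over t = x + y and t = x - y
   cancels the linear terms and leaves the gain c y^2. *)
have tg x t : 0 < x -> x <= 2 -> `|t| <= 2 ->
    x `^ p + p * x `^ (p - 1) * (t - x) + c * (t - x) ^+ 2 <= `|t| `^ p.
  move=> x0 x2 t2.
  have tg_pos w : 0 < w -> w <= 2 ->
      x `^ p + p * x `^ (p - 1) * (w - x) + c * (w - x) ^+ 2 <= w `^ p.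
    move=> w0 w2.
    suff : -1 * w `^ p + c * w `^ 2 <= -1 * x `^ p + c * x `^ 2 +
        (-1 * p * x `^ (p - 1) + c * 2 * x `^ (2 - 1)) * (w - x).
      rewrite (_ : 2 - 1 = 1 :> R); last by ring.
      rewrite (powRr1 (ltW x0)) (powR_mulrn 2 (ltW w0)) (powR_mulrn 2 (ltW x0)).
      by lra.
    apply: two_powers_tangent => // t1 w1 mt tw wM.
    have t10 : 0 < t1 by rewrite (lt_le_trans _ mt)// lt_min x0.
    have w12 : w1 <= 2 by rewrite (le_trans wM)// ge_max x2.
    apply: two_powers_le => // s /andP[ts sw].
    have s0 := lt_trans t10 ts.
    rewrite (_ : 2 - 1 - 1 = 0 :> R) ?powRr0; last by ring.
    have := P_le s s0 (ltW (lt_le_trans sw w12)).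
    rewrite -subr_ge0 => h; have := mulr_ge0 (mulr_ge0 (ltW p0) (ltW p1)) h.
    by rewrite (_ : p - 1 - 1 = p - 2); [rewrite /c; lra|ring].
  have [t0|t0|->] := ltgtP t 0; last first.
  - rewrite normr0 powR0 ?gt_eqF// !sub0r sqrrN.
    have := P_sqr x x0 x2; rewrite -subr_ge0 => h1.
    have := mulr_ge0 (ltW p1) h1.
    have : 0 <= ((p - 1) * P - c) * x ^+ 2 by rewrite mulr_ge0 ?subr_ge0 ?sqr_ge0.
    by rewrite (powM (ltW x0)); lra.
  - by rewrite gtr0_norm// tg_pos// (le_trans (ler_norm _)).
  (* Replacing [t] by [- t] does not lower the left side, since 2 c x <= p x^(p - 1). *)
  - rewrite ltr0_norm//; rewrite ltr0_norm// in t2.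
    apply: le_trans (tg_pos _ _ t2); last by rewrite oppr_gt0.
    have := P_le x x0 x2; rewrite -subr_ge0 => h.
    have : 0 <= p * (- t) * (x * (x `^ (p - 2) - P)).
      by rewrite mulr_ge0 ?mulr_ge0 ?(ltW x0) ?(ltW p0)// oppr_ge0 ltW.
    have : 0 <= p * (- t) * x * P * (2 - p).
      by rewrite !mulr_ge0 ?subr_ge0 ?(ltW x0) ?(ltW P0) ?(ltW p0)// oppr_ge0 ltW.
    by rewrite powM1// /c; lra.
have c_le : c <= 1.
  have : 0 <= (p - 1) * (1 - P) by rewrite mulr_ge0 ?subr_ge0 ?(ltW p_gt1).
  by move: p_le2; lra.
exists c; first by rewrite c0.
move=> x y; wlog x0 : x y / 0 <= x.
  move=> h; have [/h|/ltW x0] := leP 0 x; first exact.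
  move=> xy1 xy2; have := h (- x) (- y).
  rewrite oppr_ge0 -!opprD !normrN sqrrN; exact.
move=> xy1 xy2; move: x0; rewrite le_eqVlt => /predU1P[x0|x0].
  rewrite -x0 add0r sub0r normrN normr0 powR0 ?gt_eqF// in xy1 xy2 *.
  have half (t : R) : (t + t) / 2 = t by field.
  rewrite add0r half -real_normK ?num_real//.
  have [->|yn0] := eqVneq `|y| 0; first by rewrite expr0n mulr0.
  have y0 : 0 < `|y| by rewrite lt_neqAle eq_sym yn0/=.
  apply: le_trans (P_sqr _ y0 xy1); rewrite ler_wpM2r ?sqr_ge0//.
  have : 0 <= (2 - p) * P by rewrite mulr_ge0 ?subr_ge0 ?(ltW P0).
  by move: c1; lra.
have x2 : x <= 2.
  by have := ler_norm (x + y); have := ler_norm (x - y); lra.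
have := tg _ _ x0 x2 xy1; have := tg _ _ x0 x2 xy2.
by rewrite (gtr0_norm x0); lra.
Qed.

End burkholder.

(** * Bases with monotone partial sums *)

Section harmonic_rate.
Context (R : realType) (u : nat -> R) (C : R).
Hypothesis C0 : 0 < C.
Hypothesis u_rate : forall k l, `|u k - u l| <= C * (k.+1%:R^-1 + l.+1%:R^-1).

Lemma harmonic_rate_is_cvg : cvgn u.
Proof.
apply/cauchy_cvgP/cauchy_exP => e e0.
have e' : 0 < e / (2 * C) by rewrite divr_gt0// mulr_gt0.
have [N _ hN] := near_infty_natSinv_lt (PosNum e').
exists (u N), N => // l /hN /= hl; rewrite /ball/=.
apply: (le_lt_trans (u_rate _ _)); rewrite mulrC -ltr_pdivlMr//.
rewrite (_ : e / C = e / (2 * C) + e / (2 * C)); last by field; rewrite gt_eqF.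
by apply: ltrD => //; exact: (hN N (leqnn N)).
Qed.

(** Let [l] tend to infinity in [u_rate]. The bound depends on the sequence through [C] only, so it
    is uniform over the coefficients in [expansion_exists]. *)
Lemma harmonic_rate_dist_lim k : `|u k - limn u| <= C * k.+1%:R^-1.
Proof.
have cu := harmonic_rate_is_cvg.
apply/ler_addgt0Pr => e e0.
have e' : 0 < e / (2 * C) by rewrite divr_gt0// mulr_gt0.
have e2 : 0 < e / 2 by rewrite divr_gt0.
have /cvgrPdistC_lt/(_ _ e2) lim_near := cu.
near \oo => l.
have -> : u k - limn u = (u k - u l) + (u l - limn u) by rewrite addrA subrK.
have h1 : l.+1%:R^-1 < e / (2 * C).
  by near: l; exact: (near_infty_natSinv_lt (PosNum e')).
have h2 : `|u l - limn u| < e / 2 by near: l.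
have h3 : C * l.+1%:R^-1 <= e / 2.
  by rewrite mulrC -ler_pdivlMr// -mulrA -invfM; exact: ltW.
apply: (le_trans (ler_normD _ _)); have := u_rate k l.
rewrite mulrDr => /lerD /(_ (ltW h2)) /le_trans; apply.
by rewrite -addrA lerD2l [leRHS]splitr lerD2r.
Unshelve. all: by end_near. Qed.

End harmonic_rate.

Section monotone_basis.
Context (R : realType) (X : normedModType R) (z : nat -> X).
Implicit Types (a b : nat -> R) (x y : X).

Local Notation S a := (series (fun n => a n *: z n)).

Hypothesis z_norm1 : forall n, `|z n| = 1.
Hypothesis z_monotone : forall a n, `|S a n| <= `|S a n.+1|.
Hypothesis z_dense : forall x e, 0 < e -> exists a n, `|x - S a n| < e.

Let S1 a n : S a n.+1 = S a n + a n *: z n.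
Proof. by rewrite /series/= big_nat_recr. Qed.

Let SB a b n : S (fun i => a i - b i) n = S a n - S b n.
Proof.
by rewrite /series/= -sumrB; apply: eq_bigr => i _; rewrite scalerBl.
Qed.

Lemma partial_sum_le a m n : (m <= n)%N -> `|S a m| <= `|S a n|.
Proof.
by move=> /subnK<-; elim: (n - m)%N => // k /le_trans; apply; exact: z_monotone.
Qed.

(** [a i *: z i] is the difference of two consecutive partial sums, each bounded by the longer
    one. *)
Lemma coef_le_partial_sum a i n : (i < n)%N -> `|a i| <= 2 * `|S a n|.
Proof.
move=> ni; have -> : `|a i| = `|S a i.+1 - S a i|.
  by rewrite S1 addrC addKr normrZ z_norm1 mulr1.
rewrite mulr_natl mulr2n (le_trans (ler_normB _ _))//.
by rewrite lerD// partial_sum_le// ltnW.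
Qed.

Lemma partial_sum_le_lim a x n : S a @ \oo --> x -> `|S a n| <= `|x|.
Proof.
move=> ax; apply/ler_addgt0Pr => e e0.
have /cvgrPdistC_lt/(_ _ e0) ax_near := ax.
near \oo => N.
have h1 : `|S a N - x| < e by near: N.
have nN : (n <= N)%N by near: N; exact: nbhs_infty_ge.
rewrite (le_trans (partial_sum_le a nN))//.
by rewrite -(subrK x (S a N)) (le_trans (ler_normD _ _))// addrC lerD2l ltW.
Unshelve. all: by end_near. Qed.

Lemma coef_le_lim a x i : S a @ \oo --> x -> `|a i| <= 2 * `|x|.
Proof.
move=> ax; apply: (le_trans (coef_le_partial_sum a (ltnSn i))).
by rewrite ler_wpM2l// partial_sum_le_lim.
Qed.

Lemma expansion_unique a b x : S a @ \oo --> x -> S b @ \oo --> x -> a = b.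
Proof.
move=> ax bx; apply/funext => i; apply/eqP; rewrite -subr_eq0 -normr_le0.
have ab0 : S (fun i => a i - b i) @ \oo --> (0 : X).
  rewrite -(subrr x) (_ : series _ = S a - S b); first exact: cvgB.
  by apply/funext => n; exact: SB.
by rewrite (le_trans (coef_le_lim i ab0))// normr0 mulr0.
Qed.

(** Take finite sums [c k] within 1 / (k + 1) of [x]. By monotonicity, their partial sums of a
    common length are as close as the full sums, so each coefficient converges to a limit [a i], and
    the partial sums of [a] and [c k] differ by at most 1 / (k + 1), uniformly in the length. *)
Lemma expansion_exists x : exists a, S a @ \oo --> x.
Proof.
have /choice[y yP] (k : nat) : exists an : (nat -> R) * nat,
    (forall i, (an.2 <= i)%N -> an.1 i = 0) /\ `|x - S an.1 an.2| < k.+1%:R^-1.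
  have [|a [n xa]] := z_dense x (_ : 0 < k.+1%:R^-1); first by rewrite invr_gt0.
  (* Coefficients from [n] on are set to 0, so that the partial sums of [c k] are constant from
     [N k] on. *)
  exists (fun i => if (i < n)%N then a i else 0, n); split => /=.
    by move=> i; rewrite ltnNge => ->.
  congr (`|_ - _| < _): xa; rewrite /series/=.
  by apply: eq_big_nat => i /andP[_ ->].
pose c k := (y k).1; pose N k := (y k).2.
have c0 k i : (N k <= i)%N -> c k i = 0 by move: (yP k) => [+ _]; exact.
have Sc k n : (N k <= n)%N -> S (c k) n = S (c k) (N k).
  move=> /subnK<-; elim: (n - N k)%N => // m IH.
  by rewrite addSn S1 IH c0 ?scale0r ?addr0// leq_addl.
have c_near k n : (N k <= n)%N -> `|x - S (c k) n| < k.+1%:R^-1.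
  by move=> /Sc->; have [] := yP k.
have S_rate k l n : `|S (c k) n - S (c l) n| <= k.+1%:R^-1 + l.+1%:R^-1.
  pose M := maxn n (maxn (N k) (N l)).
  rewrite -SB (le_trans (@partial_sum_le _ n M _)) ?leq_maxl// SB.
  rewrite -(subrKA x) (le_trans (ler_normD _ _))// (distrC _ x).
  rewrite lerD// ltW// c_near// !leq_max leqnn ?orbT//.
have c_rate i k l : `|c k i - c l i| <= 2 * (k.+1%:R^-1 + l.+1%:R^-1).
  rewrite (le_trans (@coef_le_partial_sum (fun i => c k i - c l i) i i.+1 _))//.
  by rewrite ler_wpM2l// SB.
pose a i := limn (fun k => c k i).
have S_lim k n : `|S (c k) n - S a n| <= k.+1%:R^-1.
  apply/ler_addgt0Pr => e e0.
  have n1 : 0 < (2 * n.+1)%:R :> R by rewrite ltr0n.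
  have e' : 0 < e / ((2 * n.+1)%:R + 1) by rewrite divr_gt0// addr_gt0.
  (* The length [n] is fixed: [l] absorbs both 1 / (l + 1) and the errors of the first [n]
     coefficients of [c l], at most 2 / (l + 1) each. *)
  near \oo => l.
  have l1 : l.+1%:R^-1 < e / ((2 * n.+1)%:R + 1).
    by near: l; exact: (near_infty_natSinv_lt (PosNum e')).
  rewrite -(subrKA (S (c l) n)) (le_trans (ler_normD _ _))//.
  have h : `|S (c l) n - S a n| <= (2 * n.+1)%:R * l.+1%:R^-1.
    rewrite -SB /series/= (le_trans (ler_norm_sum _ _ _))//.
    rewrite (@le_trans _ _ (\sum_(0 <= i < n) 2 * l.+1%:R^-1))//.
      apply: ler_sum => i _; rewrite normrZ z_norm1 mulr1.
      exact: (@harmonic_rate_dist_lim _ (fun k => c k i)).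
    rewrite sumr_const_nat subn0 -[leLHS]mulr_natr mulrAC ler_wpM2r ?invr_ge0//.
    by rewrite -natrM ler_nat leq_mul.
  rewrite ltr_pdivlMr ?addr_gt0// mulrDr mulr1 mulrC in l1.
  rewrite (le_trans (lerD (S_rate k l n) h))// -addrA lerD2l addrC; exact: ltW.
exists a; apply/cvgrPdist_lt => e e0.
have e2 : 0 < e / 2 by rewrite divr_gt0.
near \oo => k.
have k1 : k.+1%:R^-1 < e / 2.
  by near: k; exact: (near_infty_natSinv_lt (PosNum e2)).
exists (N k) => // n /= Nn.
rewrite -(subrKA (S (c k) n)) (le_lt_trans (ler_normD _ _))//.
rewrite [ltRHS]splitr ltrD// ?(lt_trans (c_near k n Nn))//.
exact: le_lt_trans (S_lim k n) k1.
Unshelve. all: by end_near. Qed.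

Lemma monotone_schauder_basis : schauder_basis z.
Proof.
move=> x; have [a ax] := expansion_exists x; exists a; split=> // b bx.
exact: expansion_unique ax bx.
Qed.

End monotone_basis.

(** * The bounded bilinear form of the coefficients *)

Lemma dual_predP (R : realType) (X : normedModType R) (f : X -> R) (M : R) :
  (forall k x y, f (k *: x + y) = k * f x + f y) ->
  (forall x, `|f x| <= M * `|x|) -> (f : X -> R^o) \in @dual_pred R X.
Proof.
move=> f_lin fM; apply/asboolP; split; first exact: f_lin.
pose fL : {linear X -> R^o} := HB.pack f (GRing.isLinear.Build R X R^o *:%R f f_lin).
apply/(linear_bounded_continuous fL).
apply/linear_boundedP; near=> r => x /=.
rewrite (le_trans (fM x))// ler_wpM2r//; near: r; exact: nbhs_pinfty_ge (num_real M).
Unshelve. all: by end_near. Qed.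

Section monotone_HS_basis.
Context (R : realType) (X : normedModType R) (z : nat -> X).
Implicit Types (a b : nat -> R) (x y : X).

Local Notation S a := (series (fun n => a n *: z n)).

Hypothesis z_norm1 : forall n, `|z n| = 1.
Hypothesis z_monotone : forall a n, `|S a n| <= `|S a n.+1|.
Hypothesis z_dense : forall x e, 0 < e -> exists a n, `|x - S a n| < e.

Let coef x : nat -> R := projT1 (cid (expansion_exists z_norm1 z_monotone z_dense x)).

Let coef_cvg x : S (coef x) @ \oo --> x.
Proof. by rewrite /coef; case: cid. Qed.

Let coef_eq a x : S a @ \oo --> x -> coef x = a.
Proof. exact: (expansion_unique z_norm1 z_monotone). Qed.

Let coef_linear i k x y : coef (k *: x + y) i = k * coef x i + coef y i.
Proof.
rewrite (@coef_eq (fun i => k * coef x i + coef y i))//.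
rewrite (_ : series _ = (fun n => k *: S (coef x) n + S (coef y) n)).
  by apply: cvgD => //; apply: cvgZl_tmp.
apply/funext => n; rewrite /series/= scaler_sumr -big_split/=.
by apply: eq_bigr => j _; rewrite scalerDl scalerA.
Qed.

Let coef_z n i : coef (z n) i = (i == n)%:R.
Proof.
rewrite (@coef_eq (fun i => (i == n)%:R))//.
apply/cvgrPdist_lt => e e0; exists n.+1 => // m /= nm.
rewrite /series/= big_mkord (bigD1 (Ordinal nm))//= eqxx scale1r big1 ?addr0 ?subrr ?normr0//.
by move=> j; rewrite -val_eqE/= => /negbTE->; rewrite scale0r.
Qed.

Let coef_dual i : (fun x => coef x i : R^o) \in @dual_pred R X.
Proof.
apply: (@dual_predP _ _ _ 2) => [k x y|x]; first exact: coef_linear.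
exact: (coef_le_lim z_norm1 z_monotone).
Qed.

Variable C : R.
Hypothesis z_sqr : forall a n, `|S a n| <= 1 -> \sum_(0 <= i < n) a i ^+ 2 <= C.

Let C_ge0 : 0 <= C.
Proof.
have := @z_sqr (fun=> 0) 0.
by rewrite /series/= !big_geq// normr0 => /(_ ler01).
Qed.

Let coef_sqr x n : `|x| <= 1 -> series (fun i => coef x i ^+ 2) n <= C.
Proof.
move=> x1; apply: z_sqr; apply: le_trans x1.
exact: (partial_sum_le_lim z_monotone).
Qed.

(** Termwise, |a b| <= (a^2 + b^2) / 2. *)
Let form_normed x y n : `|x| <= 1 -> `|y| <= 1 ->
  [normed series (fun i => coef x i * coef y i)] n <= C.
Proof.
move=> x1 y1.
have -> : C = (C + C) / 2 by field.
apply: le_trans (_ : (series (fun i => coef x i ^+ 2) n +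
    series (fun i => coef y i ^+ 2) n) / 2 <= _); last first.
  by rewrite ler_pM2r// lerD// coef_sqr.
rewrite /series/= -big_split/= mulr_suml; apply: ler_sum => i _.
rewrite normrM -(real_normK (num_real (coef x i))) -(real_normK (num_real (coef y i))).
by have := sqr_ge0 (`|coef x i| - `|coef y i|); lra.
Qed.

Let formZ k l x y : (fun i => coef (k *: x) i * coef (l *: y) i) =
  (k * l) *: (fun i => coef x i * coef y i).
Proof.
have cZ i j v : coef (j *: v) i = j * coef v i.
  rewrite -[j *: v]addr0 coef_linear.
  suff -> : coef 0 i = 0 by rewrite addr0.
  by have := coef_linear i (-1) 0 0; rewrite scaler0 addr0; lra.
by apply/funext => i; rewrite !cZ mulrACA.
Qed.

Let form_is_cvg1 x y : `|x| <= 1 -> `|y| <= 1 ->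
  cvgn (series (fun i => coef x i * coef y i : R^o)).
Proof.
move=> x1 y1; apply: normed_cvg; apply: nondecreasing_is_cvgn.
  by apply: nondecreasing_series => i _ _ /=.
by exists C => _ [n _ <-]; exact: form_normed.
Qed.

(** The square bound concerns the unit ball; homogeneity of the terms carries convergence to all
    vectors. *)
Let form_is_cvg x y : cvgn (series (fun i => coef x i * coef y i)).
Proof.
have scaled v : exists k w, `|w : X| <= 1 /\ v = k *: w.
  have [->|v0] := eqVneq v 0; first by exists 0, 0; rewrite normr0 scale0r.
  exists `|v|, (`|v|^-1 *: v).
  by split; [rewrite normrZV ?unitfE ?normr_eq0|rewrite scalerA divff ?normr_eq0// scale1r].
have [[k [v [v1 ->]]] [l [w [w1 ->]]]] := (scaled x, scaled y).
rewrite formZ; exact/is_cvg_seriesZ/form_is_cvg1.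
Qed.

Let form x y := limn (series (fun i => coef x i * coef y i)).

Let form_linear k x x' y : form (k *: x + x') y = k * form x y + form x' y.
Proof.
rewrite /form; set u := fun i => coef x i * coef y i.
set v := fun i => coef x' i * coef y i.
have -> : (fun i => coef (k *: x + x') i * coef y i) = k *: u + v.
  by apply/funext => i; rewrite coef_linear mulrDl -mulrA.
have cu : cvgn (series u) by exact: form_is_cvg.
have cv : cvgn (series v) by exact: form_is_cvg.
have cku : cvgn (series (k *: u)) by exact: is_cvg_seriesZ.
by rewrite lim_seriesD// lim_seriesZ.
Qed.

Let formC x y : form x y = form y x.
Proof. by rewrite /form; under eq_fun do rewrite mulrC. Qed.

Let form_bounded x y : `|form x y| <= C * `|x| * `|y|.
Proof.
have le1 v w : `|v| <= 1 -> `|w| <= 1 -> `|form v w| <= C.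
  move=> v1 w1.
  have /cvg_norm := form_is_cvg (x := v) (y := w).
  move=> cn; rewrite -[`|form v w|](cvg_lim (@Rhausdorff R) cn)//.
  apply: limr_le; first by apply/cvg_ex; eexists; exact: cn.
  by near=> n; apply: le_trans (form_normed n v1 w1); exact: ler_norm_sum.
have formZZ k l v w : form (k *: v) (l *: w) = k * l * form v w.
  by rewrite /form formZ lim_seriesZ//; exact: form_is_cvg.
have [->|x0] := eqVneq x 0.
  by rewrite -(scale0r 0) -[y]scale1r formZZ !mul0r normr0 scale0r normr0 mulr0 mul0r.
have [->|y0] := eqVneq y 0.
  by rewrite -(scale0r 0) -[x]scale1r formZZ mulr0 mul0r normr0 scale0r normr0 mulr0.
rewrite -{1}[x]scale1r -{1}[y]scale1r.
rewrite -{1}(divff (_ : `|x| != 0)) ?normr_eq0//.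
rewrite -{1}(divff (_ : `|y| != 0)) ?normr_eq0//.
rewrite -!scalerA formZZ !normrM !normr_id.
rewrite [leRHS](_ : _ = `|x| * `|y| * C); last by ring.
rewrite ler_wpM2l ?mulr_ge0//.
by rewrite le1// normrZV ?unitfE ?normr_eq0.
Unshelve. all: by end_near. Qed.

Let form_dual x : (form x : X -> R^o) \in @dual_pred R X.
Proof.
apply: (@dual_predP _ _ _ (C * `|x|)) => [k y y'|y]; last exact: form_bounded.
by rewrite !(formC x) form_linear.
Qed.

Let Sop x : dual X := Dual (form_dual x).

Let Sop_linear : linear Sop.
Proof.
move=> k x y; apply/val_inj/funext => w.
rewrite -[RHS]/((k *: Sop x + Sop y) w) dualD dualZ.
exact: form_linear.
Qed.

(** The operator sends [x] to [form x]. All coefficients of [z n] but the [n]-th vanish, so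
    [form (z n)] is the [n]-th coefficient functional. *)
Lemma monotone_HS_basis : HS_basis z.
Proof.
split; first exact: monotone_schauder_basis.
exists (fun i => Dual (coef_dual i)) => [m n|]; first exact: coef_z.
pose SL : {linear X -> dual X} :=
  HB.pack Sop (GRing.isLinear.Build R X (dual X) *:%R Sop Sop_linear).
exists SL.
  exists C => x; apply: dual_norm_le => y y1.
  rewrite (le_trans (form_bounded x y))// ler_piMr// mulr_ge0//.
move=> n; apply/val_inj/funext => y.
rewrite -[LHS]/(form (z n) y) -[RHS]/(coef y n).
apply: cvg_lim => //; apply/cvgrPdist_lt => e e0; exists n.+1 => // m /= nm.
rewrite /series/= big_mkord (bigD1 (Ordinal nm))//= coef_z eqxx mul1r.
rewrite big1 ?addr0 ?subrr ?normr0//.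
by move=> j; rewrite -val_eqE/= coef_z => /negbTE->; rewrite mul0r.
Qed.

End monotone_HS_basis.

(** * Unconditionality from bounded subsums *)

Section suppression_unconditional.
Context (R : realType) (X : normedModType R) (z : nat -> X) (C : R).
Hypothesis z_schauder : schauder_basis z.
Hypothesis z_suppression : forall (a : nat -> R) (A : pred nat) n,
  `|\sum_(0 <= i < n | A i) a i *: z i| <= C * `|\sum_(0 <= i < n) a i *: z i|.

(** A long rearranged partial sum contains all indices below [N0]; its other terms form a subsum of
    the tail of the original series, which the suppression bound makes small. *)
Lemma suppression_unconditional_basis : unconditional_basis z.
Proof.
split=> // x a ax s [t st ts]; apply/cvgrPdist_lt => e e0.
(* A positive constant above [C], by which one can divide. *)
pose D := Num.max C 0 + 1.
have D0 : 0 < D by rewrite ltr_wpDl// le_max lexx orbT.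
have CD : C <= D by rewrite (@le_trans _ _ (Num.max C 0)) ?le_max ?lexx// lerDl.
have e' : 0 < e / 2 / (2 * D) by rewrite !divr_gt0// mulr_gt0.
have e2 : 0 < e / 2 by rewrite divr_gt0.
have /cvgrPdist_lt/(_ _ e')[N _ aN] := ax.
have /cvgrPdist_lt/(_ _ e2)[N' _ aN'] := ax.
pose N0 := maxn N N'.
(* From this length on, every index below [N0] has been met by the rearrangement. *)
exists (\max_(0 <= i < N0) (t i).+1)%N => // M /= NM.
have tM i : (i < N0)%N -> (t i < M)%N.
  by move=> iN; apply: leq_trans NM; rewrite (big_nat_widenl _ 0%N) ?leq_bigmax_seq ?mem_index_iota.
pose g i := a i *: z i.
pose N1 := maxn N0 (\max_(0 <= i < M) (s i).+1)%N.
have sN1 i : (i < M)%N -> (s i < N1)%N.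
  move=> iM; rewrite leq_max; apply/orP; right.
  by apply: (@leq_bigmax_seq _ _ predT (fun i => (s i).+1)) => //; rewrite mem_index_iota.
have -> : series (fun n => a (s n) *: z (s n)) M = \sum_(0 <= j < N1 | (t j < M)%N) g j.
  rewrite /series/= -[RHS]big_filter.
  transitivity (\sum_(j <- map s (index_iota 0 M)) g j); first by rewrite big_map.
  apply: perm_big.
  apply: uniq_perm.
  - by rewrite map_inj_uniq ?iota_uniq//; exact: can_inj st.
  - by rewrite filter_uniq ?iota_uniq.
  - move=> j; rewrite mem_filter mem_index_iota/=.
    apply/mapP/andP => [[i + ->]|[tjM jN1]].
      by rewrite mem_index_iota/= st => iM; rewrite iM sN1.
    by exists (t j); rewrite ?ts// mem_index_iota.
have N01 : (N0 <= N1)%N by rewrite leq_maxl.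
rewrite (@big_cat_nat _ _ _ N0)//=.
have -> : \sum_(0 <= j < N0 | (t j < M)%N) g j = series g N0.
  rewrite /series/= big_nat_cond [RHS]big_nat_cond; apply: eq_bigl => j /=.
  by case jN: (j < N0)%N; rewrite ?andbF// tM.
rewrite opprD addrA (le_lt_trans (ler_normB _ _))// [ltRHS]splitr ltr_leD//.
  by apply: aN'; rewrite /= leq_maxr.
(* The suppression bound is about sums starting at 0, so the first [N0] coefficients are erased. *)
pose a' i := if (N0 <= i)%N then a i else 0.
have E (P : pred nat) :
    \sum_(0 <= j < N1 | P j) a' j *: z j = \sum_(N0 <= j < N1 | P j) g j.
  rewrite (@big_cat_nat _ _ _ N0)//= big_nat_cond big1 ?add0r => [|j].
    rewrite big_nat_cond [RHS]big_nat_cond; apply: eq_bigr => j /andP[/andP[jN _] _].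
    by rewrite /a' jN.
  by move=> /andP[/andP[_ jN] _]; rewrite /a' leqNgt jN scale0r.
rewrite -E (le_trans (z_suppression a' _ N1))//.
rewrite (le_trans (ler_wpM2r _ CD))// mulrC -ler_pdivlMr// E -(@sub_series_geq _ g)//.
rewrite (@le_trans _ _ (e / 2 / (2 * D) + e / 2 / (2 * D)))//; last first.
  by rewrite le_eqVlt; apply/orP; left; apply/eqP; field; rewrite gt_eqF.
rewrite -(subrKA x) (le_trans (ler_normD _ _))// (distrC _ x) lerD// ltW//.
  by apply: aN; rewrite /= (leq_trans _ N01)// leq_maxl.
by apply: aN; rewrite /= leq_maxl.
Qed.

End suppression_unconditional.

(** * Haar functions on dyadic grids *)

Section dyadic_haar.
Context (R : realType).
Implicit Types (t : R) (G : R -> R) (a b : nat -> R).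

Definition grid (K j : nat) : R := j%:R / 2 ^+ K.

Definition cell (K j : nat) : set R := `[grid K j, grid K j.+1[.

Let pow2_gt0 K : 0 < 2 ^+ K :> R. Proof. exact: exprn_gt0. Qed.

Lemma grid_ge0 K j : 0 <= grid K j.
Proof. by rewrite divr_ge0// ltW. Qed.

Lemma grid_le K j l : (grid K j <= grid K l) = (j <= l)%N.
Proof. by rewrite ler_pM2r ?invr_gt0// ler_nat. Qed.

Lemma grid_lt K j l : (grid K j < grid K l) = (j < l)%N.
Proof. by rewrite ltr_pM2r ?invr_gt0// ltr_nat. Qed.

Lemma grid_expn K : grid K (2 ^ K) = 1.
Proof. by rewrite /grid natrX divff// gt_eqF. Qed.

Lemma grid_refine d K j : grid K j = grid (K + d) (j * 2 ^ d).
Proof.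
rewrite /grid natrM natrX exprD invfM mulrA; field.
by rewrite !gt_eqF.
Qed.

Lemma mem_cell_grid K j : cell K j (grid K j).
Proof. by rewrite /cell/= in_itv/= lexx grid_lt ltnSn. Qed.

Lemma cell_grid_le K j l t : cell K j t -> (grid K l <= t) = (l <= j)%N.
Proof.
rewrite /cell/= in_itv/= => /andP[jt tj]; apply/idP/idP => [lt|lj].
  by rewrite -ltnS -(grid_lt K) (le_lt_trans lt).
by rewrite (le_trans _ jt)// grid_le.
Qed.

(** A grid point of a coarser level is also one of level [K], so no cell of level [K] has it in its
    interior. *)
Lemma cell_coarse_le K j k l t : (k <= K)%N -> cell K j t ->
  (grid k l <= t) = (grid k l <= grid K j).
Proof.
move=> /subnKC <- jt; rewrite (grid_refine (K - k)).
by rewrite (cell_grid_le _ jt) (cell_grid_le _ (mem_cell_grid _ _)).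
Qed.

Lemma cell_disjoint K i j t : cell K i t -> cell K j t -> i = j.
Proof.
move=> ti tj; apply/eqP; rewrite eqn_leq.
rewrite -(cell_grid_le _ tj) (cell_grid_le _ ti) leqnn.
by rewrite -(cell_grid_le _ ti) (cell_grid_le _ tj) leqnn.
Qed.

Lemma cell_cover K t : 0 <= t -> t < 1 -> exists2 j, (j < 2 ^ K)%N & cell K j t.
Proof.
move=> t0 t1; pose j := Num.truncn (t * 2 ^+ K).
have /andP[jt tj] : j%:R <= t * 2 ^+ K < j.+1%:R.
  by apply: truncn_itv; rewrite mulr_ge0// ltW.
have jc : cell K j t by rewrite /cell/= in_itv/= ler_pdivrMr// ltr_pdivlMr// jt tj.
exists j => //; rewrite ltnNge -(cell_grid_le _ jc) grid_expn -ltNge//.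
Qed.

(** Here [s = i.+1]. Only comparisons with grid points remain, and [cell_grid_le] and
    [cell_coarse_le] decide these on cells. *)
Lemma haarE k i t : (i < 2 ^ k)%N -> haar (2 ^ k + i) t =
  ((grid k.+1 (2 * i) <= t) && ~~ (grid k.+1 (2 * i).+1 <= t))%:R -
  ((grid k.+1 (2 * i).+1 <= t) && ~~ (grid k.+1 (2 * i).+2 <= t))%:R.
Proof.
move=> ik; have k0 : (0 < 2 ^ k)%N by rewrite expn_gt0.
have E : trunc_log 2 (2 ^ k + i) = k.
  by apply: trunc_log_eq => //; rewrite leq_addr/= expnS mul2n -addnn ltn_add2l.
rewrite /haar; case nE : (2 ^ k + i)%N => [|n]; first by lia.
have E1 : ((2 ^ k + i).+1 - 2 ^ k = i.+1)%N by lia.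
have E2 : (2 * i.+1 - 2 = 2 * i)%N by lia.
have E3 : (2 * i.+1 - 1 = (2 * i).+1)%N by lia.
have E4 : (2 * i.+1 = (2 * i).+2)%N by lia.
rewrite -nE E E1 E2 E3 E4.
by rewrite /= !indicE !mem_setE !in_itv/= -!ltNge.
Qed.

Lemma haar_cases n : (0 < n)%N ->
  exists k i, [/\ (i < 2 ^ k)%N, n = (2 ^ k + i)%N & (n < 2 ^ k.+1)%N].
Proof.
move=> n0; have /andP[kn nk] := trunc_log_bounds (isT : (1 < 2)%N) n0.
exists (trunc_log 2 n), (n - 2 ^ trunc_log 2 n)%N.
by split=> //; move: kn nk; rewrite expnS; lia.
Qed.

(** Only the cells inside [0, 1[ matter; the point 1 is negligible for [leb01]. *)
Definition cell_const K G :=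
  forall j t, (j < 2 ^ K)%N -> cell K j t -> G t = G (grid K j).

Lemma haar_cell_const K n : (n < 2 ^ K)%N -> cell_const K (haar n).
Proof.
move=> nK j t jK jt; have [->//|n0] := posnP n.
have [k [i [ik nE _]]] := haar_cases n0.
have kK : (k.+1 <= K)%N.
  by rewrite -(@ltn_exp2l 2)// (leq_ltn_trans _ nK)// nE leq_addr.
by rewrite nE !haarE// !(cell_coarse_le _ kK jt).
Qed.

Definition haar_sum a n t : R := \sum_(0 <= i < n) a i * haar i t.

Lemma haar_sumS a n t : haar_sum a n.+1 t = haar_sum a n t + a n * haar n t.
Proof. by rewrite /haar_sum big_nat_recr. Qed.

Lemma haar_sum_cell_const a K n : (n <= 2 ^ K)%N -> cell_const K (haar_sum a n).
Proof.
move=> nK j t jK jt; apply: eq_big_nat => i /andP[_ ni].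
by rewrite (haar_cell_const (leq_trans ni nK) jK jt).
Qed.

(** For a nonnegative measurable [G] constant on the cells of level [K] this is its integral, by
    [integral_cell_const]; the estimates for Haar sums thus become finite sums. *)
Definition avg K G : R := (\sum_(0 <= j < 2 ^ K) G (grid K j)) / 2 ^+ K.

Let sum_even_odd (g : nat -> R) N :
  \sum_(0 <= j < 2 * N) g j = \sum_(0 <= j < N) (g (2 * j)%N + g (2 * j).+1).
Proof.
elim: N => [|N IH]; first by rewrite !big_geq.
by rewrite mulnS 2?big_nat_recr//= IH big_nat_recr//= addrA.
Qed.

Lemma avg_refine K G : cell_const K G -> avg K.+1 G = avg K G.
Proof.
move=> Gc; rewrite /avg expnS sum_even_odd.
have E j : (j < 2 ^ K)%N ->
    G (grid K.+1 (2 * j)) + G (grid K.+1 (2 * j).+1) = G (grid K j) * 2.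
  move=> jK.
  have Gj : grid K j = grid K.+1 (2 * j) by rewrite (grid_refine 1) addn1 mulnC.
  rewrite (Gc j (grid K.+1 (2 * j).+1))// /cell /= ?in_itv/=.
    by rewrite -Gj mulr_natr mulr2n.
  by rewrite !(grid_refine 1 K) addn1 grid_le grid_lt; lia.
under eq_big_nat => j /andP[_ jK] do rewrite E//.
by rewrite -mulr_suml exprS; field; rewrite gt_eqF.
Qed.

(** Each Haar step comes with its own level, so an induction over the steps has to change levels. *)
Lemma avg_indep K L G : cell_const K G -> cell_const L G -> avg K G = avg L G.
Proof.
wlog KL : K L / (K <= L)%N.
  by move=> h cK cL; have [/h->//|/ltnW/h->//] := leqP K L.
move=> Gc _; rewrite -(subnKC KL); elim: (L - K)%N => [|d IH]; first by rewrite addn0.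
rewrite IH addnS avg_refine// => j t jK jt.
have [j' j'K j't] : exists2 j', (j' < 2 ^ K)%N & cell K j' t.
  apply: cell_cover.
    move: jt; rewrite /cell/= in_itv/= => /andP[jt _].
    exact: le_trans (grid_ge0 _ _) jt.
  by rewrite -(grid_expn (K + d)) ltNge (cell_grid_le _ jt) -ltnNge.
rewrite (Gc j' t)// [RHS](Gc j')// /cell/= in_itv/=.
rewrite -(cell_coarse_le _ (leq_addr _ _) jt) ltNge.
rewrite -(cell_coarse_le _ (leq_addr _ _) jt) -ltNge.
by move: j't; rewrite /cell/= in_itv.
Qed.

Lemma avg_ge_point K G j : (forall t, 0 <= G t) -> (j < 2 ^ K)%N ->
  G (grid K j) / 2 ^+ K <= avg K G.
Proof.
move=> G0 jK; rewrite ler_pM2r ?invr_gt0// big_mkord (bigD1 (Ordinal jK))//=.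
by rewrite lerDl sumr_ge0.
Qed.

Lemma avg_step K i G H : (i < 2 ^ K)%N ->
  (forall j, (j < 2 ^ K)%N -> j <> i ->
    G (grid K.+1 (2 * j)) = H (grid K.+1 (2 * j)) /\
    G (grid K.+1 (2 * j).+1) = H (grid K.+1 (2 * j).+1)) ->
  avg K.+1 G - avg K.+1 H =
  (G (grid K.+1 (2 * i)) + G (grid K.+1 (2 * i).+1) -
   (H (grid K.+1 (2 * i)) + H (grid K.+1 (2 * i).+1))) / 2 ^+ K.+1.
Proof.
move=> iK GH; rewrite /avg -mulrBl; congr (_ / _).
rewrite expnS !sum_even_odd -sumrB big_mkord (bigD1 (Ordinal iK))//= big1 ?addr0// => j.
rewrite -val_eqE/= => /eqP ji; have [-> ->] := GH j (ltn_ord j) ji.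
by rewrite subrr.
Qed.

(* Adding [h_n], [n = 2 ^ k + i], changes a partial sum on the two cells of
   level [k.+1] indexed by [2 * i] and [(2 * i).+1] only, where it has a common
   value [f], into [f + a n] and [f - a n]. *)
Lemma haar_step n : (0 < n)%N -> exists K j, [/\ (n < 2 ^ K)%N, (j.+1 < 2 ^ K)%N,
  forall a, haar_sum a n.+1 (grid K j) = haar_sum a n (grid K j) + a n,
  forall a, haar_sum a n.+1 (grid K j.+1) = haar_sum a n (grid K j) - a n &
  forall a b (Phi : R -> R -> R),
    let f := haar_sum a n (grid K j) in let g := haar_sum b n (grid K j) in
    avg K (fun t => Phi (haar_sum a n.+1 t) (haar_sum b n.+1 t)) =
    avg K (fun t => Phi (haar_sum a n t) (haar_sum b n t)) +
    (Phi (f + a n) (g + b n) + Phi (f - a n) (g - b n) - 2 * Phi f g) / 2 ^+ K].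
Proof.
move=> n0; have [k [i [ik nE nK]]] := haar_cases n0.
have hn j : haar n (grid k.+1 j) = (j == 2 * i)%N%:R - (j == (2 * i).+1)%N%:R.
  rewrite nE haarE// !grid_le -!ltnNge; congr (_%:R - _%:R); lia.
(* An earlier Haar function agrees on the two halves: one of a coarser level is constant on the
   whole cell, and one of the same level vanishes there. *)
have flat m : (m < n)%N ->
    haar m (grid k.+1 (2 * i).+1) = haar m (grid k.+1 (2 * i)).
  move=> mn; have [mk|km] := ltnP m (2 ^ k).
    rewrite (haar_cell_const mk ik) => [|]; last first.
      rewrite /cell/= in_itv/= !(grid_refine 1 k) addn1 grid_le grid_lt; lia.
    by rewrite (grid_refine 1) addn1 mulnC.
  have [i' i'i mE] : exists2 i', (i' < i)%N & m = (2 ^ k + i')%N.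
    by exists (m - 2 ^ k)%N; lia.
  rewrite mE !haarE ?(ltn_trans i'i)// !grid_le.
  by congr (_%:R - _%:R); lia.
have flat_sum a : haar_sum a n (grid k.+1 (2 * i).+1) = haar_sum a n (grid k.+1 (2 * i)).
  by apply: eq_big_nat => m /andP[_ mn]; rewrite flat.
have s0 a : haar_sum a n.+1 (grid k.+1 (2 * i)) = haar_sum a n (grid k.+1 (2 * i)) + a n.
  by rewrite haar_sumS hn eqxx ltn_eqF// subr0 mulr1.
have s1 a : haar_sum a n.+1 (grid k.+1 (2 * i).+1) = haar_sum a n (grid k.+1 (2 * i)) - a n.
  by rewrite haar_sumS hn eqxx gtn_eqF// sub0r mulrN1 flat_sum.
exists k.+1, (2 * i)%N; split=> //; first by rewrite expnS; lia.
move=> a b Phi f g.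
pose G t := Phi (haar_sum a n.+1 t) (haar_sum b n.+1 t).
pose H t := Phi (haar_sum a n t) (haar_sum b n t).
rewrite -[LHS](subrK (avg k.+1 H)) addrC; congr (_ + _).
rewrite (@avg_step k i G H ik) => [|j _ ji]; last first.
  have [E1 E2 E3 E4] : [/\ (2 * j == 2 * i) = false, (2 * j == (2 * i).+1) = false,
      ((2 * j).+1 == 2 * i) = false & ((2 * j).+1 == (2 * i).+1) = false].
    by split; apply/eqP; lia.
  by rewrite /G /H !haar_sumS !hn E1 E2 E3 E4 subrr !mulr0 !addr0.
by rewrite /G /H !s0 !s1 !flat_sum /f /g; congr (_ / _); ring.
Qed.

(** From level to level: the first [2 ^ K] coefficients interpolate the means over the two halves of
    each cell, and half the difference is the coefficient of the Haar function supported on that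
    cell. *)
Lemma haar_sum_interpolation (v : nat -> R) K :
  exists b, forall j, (j < 2 ^ K)%N -> haar_sum b (2 ^ K) (grid K j) = v j.
Proof.
elim: K v => [|K IH] v.
  exists v => j; rewrite expn0 ltnS leqn0 => /eqP->.
  by rewrite /haar_sum big_nat1 mulr1.
have [b bP] := IH (fun j => (v (2 * j)%N + v (2 * j).+1) / 2).
pose c m := if (m < 2 ^ K)%N then b m
            else (v (2 * (m - 2 ^ K))%N - v (2 * (m - 2 ^ K)).+1) / 2.
exists c => l lK; pose j := l./2; have jK : (j < 2 ^ K)%N by rewrite expnS in lK; lia.
have lj : cell K j (grid K.+1 l).
  rewrite /cell/= in_itv/= !(grid_refine 1 K) addn1 grid_le grid_lt; lia.
rewrite /haar_sum (@big_cat_nat _ _ _ (2 ^ K))//=; last by rewrite leq_exp2l.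
have -> : \sum_(0 <= m < 2 ^ K) c m * haar m (grid K.+1 l) =
    (v (2 * j)%N + v (2 * j).+1) / 2.
  rewrite -bP// -(haar_sum_cell_const b (leqnn _) jK lj).
  by apply: eq_big_nat => m /andP[_ mK]; rewrite /c mK.
have -> : (2 ^ K.+1 = 2 ^ K + 2 ^ K)%N by rewrite expnS; lia.
rewrite -{1}[(2 ^ K)%N]add0n big_addn addnK.
rewrite big_mkord (bigD1 (Ordinal jK))//= big1 ?addr0 => [|m mj].
  rewrite /c ltnNge leq_addl/= addnK addnC haarE// !grid_le -!ltnNge.
  have [lE|lE] : l = (2 * j)%N \/ l = (2 * j).+1 by rewrite /j; lia.
    have -> : (2 * j <= l)%N && (l < (2 * j).+1)%N by lia.
    have -> : (2 * j < l)%N && (l < (2 * j).+2)%N = false by lia.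
    have -> : v l = v (2 * j)%N by congr v.
    by rewrite subr0 mulr1; field.
  have -> : (2 * j <= l)%N && (l < (2 * j).+1)%N = false by lia.
  have -> : (2 * j < l)%N && (l < (2 * j).+2)%N by lia.
  have -> : v l = v (2 * j).+1 by congr v.
  by rewrite sub0r mulrN1; field.
rewrite addnC haarE// !grid_le -!ltnNge; move: mj; rewrite -val_eqE/= => /eqP mj.
have -> : (2 * m <= l)%N && (l < (2 * m).+1)%N = false by rewrite /j in mj; lia.
have -> : (2 * m < l)%N && (l < (2 * m).+2)%N = false by rewrite /j in mj; lia.
by rewrite subrr mulr0.
Qed.

End dyadic_haar.

(** * Norms of Haar sums *)

Section leb01_integral.
Context (R : realType).
Implicit Types (t : R) (f G : R -> R).

Local Notation mu := (leb01 R).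

Let mI K j : measurable (cell K j : set (measurableTypeR R)).
Proof. exact: measurable_itv. Qed.

(** The cells cover [0, 1[, and the remaining point 1 is a null set. *)
Lemma leb01_ae (P : R -> Prop) :
  (forall t, 0 <= t -> t < 1 -> P t) -> {ae mu, forall t, P t}.
Proof.
move=> P01; exists (~` `[0, 1[%classic); split.
- by apply: measurableC; exact: measurable_itv.
- rewrite /leb01/= /mrestr (_ : _ `&` _ = [set 1]) ?lebesgue_measure_set1//.
  apply/seteqP; split=> t /=; rewrite !in_itv/=.
    move=> [/negP]; rewrite negb_and -leNgt => + /andP[t0 t1].
    by rewrite t0/= => t1'; apply/eqP; rewrite eq_le t1 t1'.
  by move=> ->; rewrite ltxx andbF ler01 lexx.
- move=> t /= nP; rewrite in_itv/= => /andP[t0 t1]; apply: nP; exact: P01.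
Qed.

Lemma leb01_cell K j : (j < 2 ^ K)%N -> mu (cell K j) = (2 ^- K)%:E.
Proof.
move=> jK; rewrite /leb01/= /mrestr setIidl.
  rewrite /cell lebesgue_measure_itv/= lte_fin grid_lt ltnSn -EFinB.
  by rewrite /grid -mulrBl -natrB// subSnn mul1r.
move=> t /=; rewrite /cell/= !in_itv/= => /andP[jt tj].
rewrite (le_trans (grid_ge0 _ _ _) jt)/= (le_trans (ltW tj))//.
by rewrite -(grid_expn _ K) grid_le.
Qed.

Lemma leb01_setT : mu setT = 1%E.
Proof.
by rewrite /leb01/= /mrestr setTI lebesgue_measure_itv/= lte_fin ltr01 sube0.
Qed.

Lemma integral_cell_const K G : measurable_fun setT G -> (forall t, 0 <= G t) ->
  cell_const K G -> (\int[mu]_t (G t)%:E = (avg K G)%:E)%E.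
Proof.
move=> mG G0 Gc.
transitivity (\int[mu]_t
    (\sum_(0 <= j < 2 ^ K) (G (grid R K j) * \1_(cell K j) t)%:E))%E.
  apply: ge0_ae_eq_integral => //.
  - exact/measurable_EFinP.
  - apply: emeasurable_sum => j; apply/measurable_EFinP.
    by apply: measurable_funM => //; exact: measurable_indic.
  - by move=> t _; rewrite lee_fin.
  - by move=> t _; apply: sume_ge0 => j _; rewrite lee_fin mulr_ge0.
  - apply: leb01_ae => t t0 t1 _.
    have [j jK jt] := cell_cover K t0 t1.
    rewrite sumEFin big_mkord (bigD1 (Ordinal jK))//= indicE mem_set// mulr1.
    rewrite big1 ?addr0 ?(Gc j)// => i; rewrite -val_eqE/= => /eqP ij.
    by rewrite indicE memNset ?mulr0// => it; apply: ij; exact: cell_disjoint it jt.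
rewrite ge0_integral_sum//; last 2 first.
- move=> j; apply/measurable_EFinP.
  by apply: measurable_funM => //; exact: measurable_indic.
- by move=> j t _; rewrite lee_fin mulr_ge0.
rewrite /avg mulr_suml -sumEFin big_nat_cond [RHS]big_nat_cond.
apply: eq_bigr => j /andP[/andP[_ jK] _].
under eq_integral do rewrite EFinM.
rewrite ge0_integralZl ?lee_fin//; last first.
  by apply/measurable_EFinP; exact: measurable_indic.
rewrite integral_indic// setIT EFinM; congr (_ * _)%E; exact: leb01_cell.
Qed.

End leb01_integral.

Section haar_Lp_norm.
Context (R : realType) (p : R) (p_gt1 : 1 < p).
Let p1 := lee1_fin p_gt1.
Let p0 : 0 < p. Proof. exact: lt_trans p_gt1. Qed.
Local Notation mu := (leb01 R).
Local Notation Lp := (LspaceType mu p1).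
Implicit Types (u : Lp) (f : R -> R) (a : nat -> R).

Lemma powR_normLp u f : measurable_fun setT f -> u = f %[ae mu] ->
  ((`|u| `^ p)%:E = \int[mu]_t (`|f t| `^ p)%:E)%E.
Proof.
move=> mf uf; rewrite -poweR_EFin -[`|u|]/(Lspace_norm u) Lspace_normE.
rewrite (ae_eq_Lnorm p1 (@Lspace_measurable _ _ _ _ _ _ u) mf uf).
by rewrite powR_Lnorm ?gt_eqF.
Qed.

Lemma measurable_haar_sum a n : measurable_fun setT (haar_sum a n : R -> R).
Proof.
apply: measurable_sum => i; apply: measurable_funM => //.
exact: measurable_haar.
Qed.

Lemma haar_Lp_sum a n :
  \sum_(0 <= i < n) a i *: haar_Lp p1 i = haar_sum a n %[ae mu].
Proof.
elim: n => [|n IH].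
  rewrite big_geq//; apply: ae_eq_trans (Lspace_0E mu p1) _.
  by near=> t => _; rewrite /haar_sum big_geq.
rewrite big_nat_recr//.
have h1 := Lspace_addE (\sum_(0 <= i < n) a i *: haar_Lp p1 i) (a n *: haar_Lp p1 n).
have h2 := Lspace_scaleE (a n) (haar_Lp p1 n).
have h3 := Lspace_ofE p1 (haar_Lfun p1 n).
near=> t => _.
rewrite (near h1)// (near IH)// (near h2)// (near h3)//.
by rewrite haar_sumS.
Unshelve. all: by end_near. Qed.

Lemma powR_norm_haar_sum a n K : (n <= 2 ^ K)%N ->
  `|\sum_(0 <= i < n) a i *: haar_Lp p1 i| `^ p =
  avg K (fun t => `|haar_sum a n t| `^ p).
Proof.
move=> nK; apply: EFin_inj.
rewrite (powR_normLp (measurable_haar_sum a n) (haar_Lp_sum a n)).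
apply: integral_cell_const => //.
- apply: (@measurableT_comp _ _ _ _ _ _ (@powR R ^~ p)) => //.
  by apply: measurableT_comp => //; exact: measurable_haar_sum.
- by move=> j t jK jt /=; rewrite (haar_sum_cell_const a nK jK jt).
Qed.

End haar_Lp_norm.

(** * Density of Haar sums in L^p *)

Section haar_dense.
Context (R : realType) (p : R) (p_gt1 : 1 < p).
Let p1 := lee1_fin p_gt1.
Let p0 : 0 < p. Proof. exact: lt_trans p_gt1. Qed.
Local Notation mu := (leb01 R).
Local Notation Lp := (LspaceType mu p1).
Implicit Types (u v : Lp) (f g h : R -> R) (a : nat -> R).

Let measurable_powR_norm f : measurable_fun setT f ->
  measurable_fun setT (fun t => (`|f t| `^ p)%:E : \bar R).
Proof.
move=> mf; apply/measurable_EFinP.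
apply: (@measurableT_comp _ _ _ _ _ _ (@powR R ^~ p)) => //.
exact: measurableT_comp.
Qed.

Lemma Lp_dist_lt u v f g e : measurable_fun setT f -> measurable_fun setT g ->
  u = f %[ae mu] -> v = g %[ae mu] -> 0 < e ->
  (\int[mu]_t (`|f t - g t| `^ p)%:E < (e `^ p)%:E)%E -> `|u - v| < e.
Proof.
move=> mf mg uf vg e0; rewrite -(@powR_normLp _ _ _ (u - v) (fun t => f t - g t)).
- rewrite lte_fin; apply: contraTT; rewrite -!leNgt => ev.
  by rewrite ge0_ler_powR ?(ltW p0) ?nnegrE ?(ltW e0).
- exact: measurable_funB.
- have h1 := Lspace_addE u (- v).
  have h2 := Lspace_oppE v.
  near=> t => _.
  by rewrite (near h1)// (near h2)// (near uf)// (near vg).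
Unshelve. all: by end_near. Qed.

Lemma bounded_Lfun f M : measurable_fun setT f -> (forall t, `|f t| <= M) ->
  (f : measurableTypeR R -> R) \in Lfun mu p%:E.
Proof.
move=> mf fM; apply/andP; split; apply/mem_set => //.
rewrite /= /finite_norm unlock poweR_lty//.
apply: (@le_lt_trans _ _ (\int[mu]_x (cst (M `^ p)%:E x))%E).
  apply: ge0_le_integral => //.
  - by move=> x _; exact: poweR_ge0.
  - exact: (measurable_powR_norm mf).
  - by move=> x _ /=; rewrite lee_fin ge0_ler_powR ?(ltW p0)// nnegrE (le_trans _ (fM x)).
by rewrite integral_cst// leb01_setT mule1 ltry.
Qed.

(** Dominated convergence for the p-th powers, used both for truncations and for dyadic
    interpolation. *)
Lemma Lp_dominated_approx f (f_ : nat -> R -> R) g e : 0 < e ->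
  measurable_fun setT f -> (forall n, measurable_fun setT (f_ n)) ->
  measurable_fun setT g -> (\int[mu]_t (`|g t| `^ p)%:E < +oo)%E ->
  (forall t, 0 <= t -> t < 1 -> f_ ^~ t @ \oo --> f t) ->
  (forall n t, 0 <= t -> t < 1 -> `|f t - f_ n t| <= `|g t|) ->
  exists n, (\int[mu]_t (`|f t - f_ n t| `^ p)%:E < e%:E)%E.
Proof.
move=> e0 mf mf_ mg gp f_f f_g.
have [] := @dominated_convergence _ _ R mu setT measurableT
  (fun n t => (`|f t - f_ n t| `^ p)%:E) (cst 0%E) (fun t => (`|g t| `^ p)%:E).
- by move=> n; apply: measurable_powR_norm; exact: measurable_funB.
- exact: measurable_cst.
- apply: leb01_ae => t t0 t1 _; apply: cvg_EFin; first by near=> n.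
  apply/cvgrPdist_lt => d d0.
  have d' : 0 < d `^ p^-1 by rewrite powR_gt0.
  have /cvgrPdist_lt/(_ _ d') := f_f t t0 t1.
  apply: filterS => n /= fd; rewrite sub0r normrN ger0_norm ?powR_ge0//.
  rewrite -[ltRHS](@powRr1 _ d) ?(ltW d0)// -(mulVf (lt0r_neq0 p0)) powRrM.
  by rewrite gt0_ltr_powR// nnegrE ?powR_ge0.
- apply/integrableP; split; first exact: measurable_powR_norm.
  by under eq_integral do rewrite gee0_abs ?lee_fin ?powR_ge0//.
- apply: leb01_ae => t t0 t1 n _.
  rewrite gee0_abs ?lee_fin ?powR_ge0//.
  by rewrite ge0_ler_powR ?(ltW p0) ?nnegrE// f_g.
move=> _ _; rewrite integral0 => /= /fine_cvgP[fin] /cvgrPdist_lt/(_ _ e0) lim0.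
have [n [nfin nlim]] : exists n, (\int[mu]_t (`|f t - f_ n t| `^ p)%:E \is a fin_num)%E /\
    `|0 - fine (\int[mu]_t (`|f t - f_ n t| `^ p)%:E)%E| < e.
  near \oo => n; exists n; split; near: n; [exact: fin|exact: lim0].
exists n; rewrite -(fineK nfin) lte_fin.
by move: nlim; rewrite sub0r normrN; apply: le_lt_trans; exact: ler_norm.
Unshelve. all: by end_near. Qed.

Definition clamp (M x : R) : R := Num.max (- M) (Num.min x M).

Lemma clamp_le M x : 0 <= M -> `|clamp M x| <= M.
Proof.
move=> M0; rewrite /clamp ler_norml le_max lexx/= ge_max ge_min lexx orbT andbT.
by rewrite (le_trans _ M0)// oppr_le0.
Qed.

Lemma clamp_id M x : `|x| <= M -> clamp M x = x.
Proof. by rewrite ler_norml => /andP[Mx xM]; rewrite /clamp min_l// max_r. Qed.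

Lemma clamp_dist M x y : `|x| <= M -> `|x - clamp M y| <= `|x - y|.
Proof.
rewrite ler_norml => /andP[Mx xM]; rewrite /clamp.
have [yM|My] := leP y M; have [h1|h1] := leP (- M) _.
- by [].
- by rewrite !ger0_norm; lra.
- by rewrite distrC [leRHS]distrC !ger0_norm; lra.
- by lra.
Qed.

Lemma clamp_dist_le M x : 0 <= M -> `|x - clamp M x| <= `|x|.
Proof.
move=> M0; rewrite /clamp; have [xM|Mx] := leP x M; have [h1|h1] := leP (- M) _.
- by rewrite subrr normr0.
- by rewrite !ler0_norm; lra.
- by rewrite !ger0_norm; lra.
- by lra.
Qed.

Lemma measurable_clamp M f : measurable_fun setT f ->
  measurable_fun setT (fun t => clamp M (f t)).
Proof.
move=> mf; apply: measurable_maxr; first exact: measurable_cst.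
by apply: measurable_minr => //; exact: measurable_cst.
Qed.

Lemma Lp_bounded_dense u e : 0 < e -> exists f M,
  [/\ measurable_fun setT f, forall t, `|f t| <= M &
      forall fL : (f : measurableTypeR R -> R) \in Lfun mu p%:E,
        `|u - Lspace_of p1 fL| < e].
Proof.
move=> e0; have mu_ := @Lspace_measurable _ _ _ _ _ _ u.
have [| |n nP] := @Lp_dominated_approx u (fun n t => clamp n%:R (u t)) u (e `^ p)
  (powR_gt0 _ e0) mu_ (fun n => measurable_clamp _ mu_) mu_ _ _
  (fun n t _ _ => clamp_dist_le (u t) (ler0n R n)).
- by rewrite -(powR_normLp mu_ (ae_eq_refl _ _ _)) ltry.
- move=> t _ _; apply/cvgrPdist_lt => d d0.
  near=> n; rewrite clamp_id ?subrr ?normr0//.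
  near: n; exact: nbhs_infty_ger.
exists (fun t => clamp n%:R (u t)), n%:R; split.
- exact: measurable_clamp.
- by move=> t; exact: clamp_le.
- move=> fL; exact: (Lp_dist_lt mu_ (measurable_clamp _ mu_) (ae_eq_refl _ _ _)
    (Lspace_ofE p1 fL) e0 nP).
Unshelve. all: by end_near. Qed.

Lemma integral_leb01 f : measurable_fun setT f -> (forall t, 0 <= f t) ->
  (\int[mu]_t (f t)%:E = \int[lebesgue_measure]_(t in `[0%R, 1%R]) (f t)%:E)%E.
Proof.
move=> mf f0.
have mI : measurable (~` `[0, 1] : set (measurableTypeR R)).
  by apply: measurableC; exact: measurable_itv.
rewrite (@ge0_negligible_integral _ _ _ mu setT (~` `[0, 1]))//.
- rewrite setDE setTI setCK.
  by apply: eq_measure_integral => A mA AI; rewrite /leb01/= /mrestr setIidl.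
- exact/measurable_EFinP.
- by move=> t _; rewrite lee_fin.
- by rewrite /leb01/= /mrestr setICl measure0.
Qed.

(** Continuous functions are dense in L^1. Clamping an approximant to [-M, M] does not increase its
    distance to [f], and between functions bounded by [M] the L^1 distance controls the integral of
    the p-th power. *)
Lemma bounded_continuous_approx f M e : measurable_fun setT f ->
  (forall t, `|f t| <= M) -> 0 < e ->
  exists g, [/\ continuous g, forall t, `|g t| <= M &
    (\int[mu]_t (`|f t - g t| `^ p)%:E < e%:E)%E].
Proof.
move=> mf fM e0; have M0 : 0 <= M by rewrite (le_trans _ (fM 0)).
(* From |f - g| <= 2 M follows |f - g|^p <= (2 M)^(p - 1) |f - g|; the added 1 keeps [C]
   positive. *)
pose C := (2 * M) `^ (p - 1) + 1.
have C0 : 0 < C by rewrite ltr_wpDl// powR_ge0.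
have mI : measurable (`[0, 1] : set (measurableTypeR R)) by exact: measurable_itv.
have finI : (lebesgue_measure (`[0%R, 1%R] : set (measurableTypeR R)) < +oo)%E.
  by rewrite lebesgue_measure_itv/= lte_fin ltr01 sube0 ltry.
have int_f : lebesgue_measure.-integrable `[0, 1] (EFin \o f).
  apply: measurable_bounded_integrable => //; first exact: measurable_funTS.
  exists M; split; first exact: num_real.
  by move=> x Mx t _; exact: le_trans (fM t) (ltW Mx).
have [g_ [cg _]] := approximation_continuous_integrable mI finI int_f.
move=> /fine_cvgP[fin] /cvgrPdist_lt/(_ (e / C) (divr_gt0 e0 C0)) lim0.
have [n [nfin nlim]] : exists n,
    (\int[lebesgue_measure]_(z in `[0%R, 1%R]) `|(f z - g_ n z)%:E| \is a fin_num)%E /\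
    `|0 - fine (\int[lebesgue_measure]_(z in `[0%R, 1%R]) `|(f z - g_ n z)%:E|)%E| < e / C.
  near \oo => n; exists n; split; near: n; [exact: fin|exact: lim0].
have mg : measurable_fun setT (g_ n) by exact: continuous_measurable_fun.
pose g t := clamp M (g_ n t).
have mgM : measurable_fun setT g by exact: measurable_clamp.
exists g; split.
- move=> t; apply: (@continuous_max R R (cst (- M)) (g_ n \min cst M)).
    exact: cvg_cst.
  by apply: (@continuous_min R R); [exact: cg|exact: cvg_cst].
- by move=> t; exact: clamp_le.
apply: (@le_lt_trans _ _ (\int[mu]_t (C * `|f t - g_ n t|)%:E)%E).
  apply: ge0_le_integral => //.
  - by apply: measurable_powR_norm; exact: measurable_funB.
  - apply/measurable_EFinP; apply: measurable_funM => //.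
    by apply: measurableT_comp => //; exact: measurable_funB.
  - move=> t _; rewrite lee_fin.
    have fg : `|f t - g t| <= 2 * M.
      have := clamp_le (g_ n t) M0; have := fM t; rewrite -/(g t).
      by have := ler_normB (f t) (g t); lra.
    rewrite -(@mulr_powRB1 _ _ p)// mulrC; apply: ler_pM => //.
      rewrite /C (@le_trans _ _ ((2 * M) `^ (p - 1)))// ?lerDl//.
      by rewrite ge0_ler_powR ?subr_ge0 ?(ltW p_gt1)// nnegrE (le_trans _ fg).
    exact: clamp_dist.
rewrite integral_leb01; last 2 first.
- apply: measurable_funM => //.
  by apply: measurableT_comp => //; exact: measurable_funB.
- by move=> t; rewrite mulr_ge0// ltW.
under eq_integral do rewrite EFinM.
rewrite ge0_integralZl//; last 2 first.
- apply/measurable_EFinP/measurable_funTS; apply: measurableT_comp => //.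
  exact: measurable_funB.
- by rewrite lee_fin ltW.
move: nlim; rewrite sub0r normrN ger0_norm; last by apply: fine_ge0; exact: integral_ge0.
rewrite ltr_pdivlMr// mulrC => nlim.
by rewrite -(fineK nfin) -EFinM lte_fin.
Unshelve. all: by end_near. Qed.

(** The Haar sums interpolating [g] at the dyadic points converge pointwise on [0, 1[ by continuity,
    with differences bounded by 2 M. *)
Lemma continuous_haar_approx g M e : continuous g -> (forall t, `|g t| <= M) ->
  0 < e -> exists a n, (\int[mu]_t (`|g t - haar_sum a n t| `^ p)%:E < e%:E)%E.
Proof.
move=> cg gM e0; have M0 : 0 <= M by rewrite (le_trans _ (gM 0)).
have /choice[b bP] K := haar_sum_interpolation (fun j => g (grid R K j)) K.
have mg : measurable_fun setT g by exact: continuous_measurable_fun.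
have [| |n t t0 t1|n nP] := @Lp_dominated_approx g
  (fun K => haar_sum (b K) (2 ^ K)) (cst (2 * M)) e e0 mg
  (fun K => @measurable_haar_sum R (b K) (2 ^ K)) (measurable_cst _); last first.
- by exists (b n), (2 ^ n)%N.
- have [j jn jt] := cell_cover n t0 t1.
  rewrite (haar_sum_cell_const (b n) (leqnn _) jn jt) bP//=.
  rewrite [leRHS]ger0_norm ?mulr_ge0// mulr_natl mulr2n.
  by rewrite (le_trans (ler_normB _ _))// lerD.
- move=> t t0 t1; apply/cvgrPdist_lt => d d0.
  have /cvgrPdist_lt/(_ _ d0)/nbhs_ballP[r /= r0 rP] := cg t.
  near=> K.
  have [j jK jt] := cell_cover K t0 t1.
  rewrite (haar_sum_cell_const (b K) (leqnn _) jK jt) bP//.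
  apply: rP; rewrite /ball/=.
  have Kr : 2 ^- K < r.
    rewrite -[2 ^- K]div1r; near: K.
    exact: (near_infty_natSinv_expn_lt (PosNum r0)).
  apply: le_lt_trans Kr; move: jt; rewrite /cell/= in_itv/= => /andP[jt tj].
  rewrite ger0_norm ?subr_ge0// lerBlDl (le_trans (ltW tj))//.
  by rewrite /grid -natr1 mulrDl mul1r.
- rewrite -[X in (X < _)%E]/(\int[mu]_t cst (`|2 * M| `^ p)%:E t)%E.
  by rewrite integral_cst// leb01_setT mule1 ltry.
Unshelve. all: by end_near. Qed.

Lemma haar_Lp_dense u e : 0 < e ->
  exists a n, `|u - \sum_(0 <= i < n) a i *: haar_Lp p1 i| < e.
Proof.
move=> e0; have e3 : 0 < e / 3 by rewrite divr_gt0.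
have e3p : 0 < (e / 3) `^ p by rewrite powR_gt0.
have [f [M [mf fM uf]]] := Lp_bounded_dense u e3.
have [g [cg gM fg]] := bounded_continuous_approx mf fM e3p.
have mg : measurable_fun setT g by exact: continuous_measurable_fun.
have [a [n gh]] := continuous_haar_approx cg gM e3p.
exists a, n; have fL := bounded_Lfun mf fM; have gL := bounded_Lfun mg gM.
have h1 := uf fL.
have h2 := Lp_dist_lt mf mg (Lspace_ofE p1 fL) (Lspace_ofE p1 gL) e3 fg.
have h3 := Lp_dist_lt mg (measurable_haar_sum a n) (Lspace_ofE p1 gL)
  (haar_Lp_sum p_gt1 a n) e3 gh.
rewrite -(subrKA (Lspace_of p1 fL)) (le_lt_trans (ler_normD _ _))//.
rewrite -(subrKA (Lspace_of p1 gL) (Lspace_of p1 fL)).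
rewrite (le_lt_trans (lerD (lexx _) (ler_normD _ _)))//.
rewrite (_ : e = e / 3 + (e / 3 + e / 3)); last by field.
by rewrite ltrD// ltrD.
Qed.

End haar_dense.

(** * Two-point estimates for Haar sums *)

Section haar_unconditional.
Context (R : realType) (p : R) (p_gt1 : 1 < p) (p_le2 : p <= 2).
Let p1 := lee1_fin p_gt1.
Let p0 : 0 < p. Proof. exact: lt_trans p_gt1. Qed.
Implicit Types (a : nat -> R).

Local Notation H := (haar_Lp p1).
Local Notation T a n := (\sum_(0 <= i < n) a i *: H i).

Let pow2_gt0 K : 0 < 2 ^+ K :> R. Proof. exact: exprn_gt0. Qed.

Let one_powR : 1 `^ p = 1 :> R. Proof. by rewrite powR1. Qed.

Let ler_powRp (x y : R) : 0 <= x -> 0 <= y -> (x `^ p <= y `^ p) = (x <= y).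
Proof.
move=> x0 y0; apply/idP/idP => [|xy]; last by rewrite ge0_ler_powR ?(ltW p0).
by apply: contraTT; rewrite -!ltNge => yx; rewrite gt0_ltr_powR.
Qed.

Let T_delta n (c : R) : T (fun i => (i == n)%:R * c) n.+1 = c *: H n.
Proof.
rewrite big_nat_recr//= eqxx mul1r big_nat_cond big1 ?add0r// => i /andP[/andP[_ ni] _].
by rewrite ltn_eqF// mul0r scale0r.
Qed.

(** [f] is the value of the partial sum on the support of [h_n], each half of which has measure
    2^-K. The last two bounds keep only one half in the norm. *)
Lemma norm_haar_step n : (0 < n)%N -> exists K,
  [/\ `|H n| `^ p = 2 / 2 ^+ K & forall a, exists f : R,
  [/\ `|T a n.+1| `^ p = `|T a n| `^ p +
        (`|f + a n| `^ p + `|f - a n| `^ p - 2 * `|f| `^ p) / 2 ^+ K,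
      `|f + a n| `^ p / 2 ^+ K <= `|T a n.+1| `^ p &
      `|f - a n| `^ p / 2 ^+ K <= `|T a n.+1| `^ p]].
Proof.
move=> n0; have [K [j [nK jK s0 s1 step]]] := haar_step R n0.
have nK' := ltnW nK.
have stepT a : `|T a n.+1| `^ p = `|T a n| `^ p +
    (`|haar_sum a n (grid R K j) + a n| `^ p + `|haar_sum a n (grid R K j) - a n| `^ p -
     2 * `|haar_sum a n (grid R K j)| `^ p) / 2 ^+ K.
  rewrite (powR_norm_haar_sum p_gt1 a nK) (powR_norm_haar_sum p_gt1 a nK').
  exact: (step a a (fun x _ => `|x| `^ p)).
exists K; split=> [|a].
  (* The norm of [h_n] is read off the step of the sequence whose only nonzero coefficient is the
     [n]-th. *)
  pose b i : R := (i == n)%:R * 1; have := stepT b.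
  rewrite T_delta scale1r.
  have b0 : forall i, (i < n)%N -> b i = 0 by move=> i /ltn_eqF; rewrite /b => ->; rewrite mul0r.
  have -> : T b n = 0.
    by rewrite big_nat_cond big1// => i /andP[/andP[_ ni] _]; rewrite b0// scale0r.
  have -> : haar_sum b n (grid R K j) = 0.
    by rewrite /haar_sum big_nat_cond big1// => i /andP[/andP[_ ni] _]; rewrite b0// mul0r.
  rewrite /b eqxx mulr1 add0r sub0r normrN normr1 normr0 powR1 normr0 powR0 ?gt_eqF//.
  by rewrite add0r mulr0 subr0.
exists (haar_sum a n (grid R K j)); split; first exact: stepT.
- rewrite -s0 (powR_norm_haar_sum p_gt1 a nK).
  apply: (avg_ge_point (G := fun t => `|haar_sum a n.+1 t| `^ p)) => //; exact: ltnW.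
- rewrite -s1 (powR_norm_haar_sum p_gt1 a nK).
  exact: (avg_ge_point (G := fun t => `|haar_sum a n.+1 t| `^ p)).
Qed.

Lemma norm_haar0 : `|H 0| = 1.
Proof.
have := powR_norm_haar_sum p_gt1 (fun i => (i == 0)%:R * 1) (isT : (1 <= 2 ^ 0)%N).
rewrite T_delta scale1r /avg expn0 expr0 big_nat1 divr1 /haar_sum big_nat1 /= !mulr1.
rewrite normr1 powR1 => H0.
by apply: (powR_injective p0); rewrite ?nnegrE// H0 powR1.
Qed.

Lemma norm_haar_gt0 n : 0 < `|H n|.
Proof.
have [->|n0] := posnP n; first by rewrite norm_haar0.
have [K [HK _]] := norm_haar_step n0.
rewrite lt_neqAle normr_ge0 andbT eq_sym; apply/eqP => H0.
move: HK; rewrite H0 powR0 ?gt_eqF// => /esym/eqP.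
by rewrite mulf_eq0 invr_eq0 !gt_eqF.
Qed.

(** The supporting line of |t|^p at [f], taken at f + a n and f - a n, loses its linear term in the
    sum. *)
Lemma norm_haar_sum_le a n : `|T a n| <= `|T a n.+1|.
Proof.
have [->|n0] := posnP n; first by rewrite big_geq// normr0.
have [K [_ /(_ a)[f [E _ _]]]] := norm_haar_step n0.
rewrite -ler_powRp// E lerDl divr_ge0// ?(ltW (pow2_gt0 K))// subr_ge0.
have [D Df] := normr_powR_tangent p_gt1 f.
by have := Df (f + a n); have := Df (f - a n); lra.
Qed.

(** Each Haar term goes to only one of the two sums, so concavity in that variable keeps the average
    from increasing. The first term leaves the pair on a coordinate axis, where the function is
    nonpositive. *)
Lemma burkholder_avg_le0 a (A : pred nat) n K : (n <= 2 ^ K)%N ->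
  avg K (fun t => burkholder p (haar_sum (fun i => if A i then a i else 0) n t)
    (haar_sum (fun i => if A i then 0 else a i) n t)) <= 0.
Proof.
set b := fun i => if A i then a i else 0; set c := fun i => if A i then 0 else a i.
have avg_le0 L (G : R -> R) : (forall t, G t <= 0) -> avg L G <= 0.
  by move=> G0; rewrite /avg mulr_le0_ge0 ?invr_ge0 ?(ltW (pow2_gt0 L))// sumr_le0.
have const_avg m L : (m <= 2 ^ L)%N ->
    cell_const L (fun t => burkholder p (haar_sum b m t) (haar_sum c m t)).
  move=> mL j t jL jt.
  by rewrite (haar_sum_cell_const b mL jL jt) (haar_sum_cell_const c mL jL jt).
elim: n K => [|n IH] K nK.
  by apply: avg_le0 => t; rewrite /haar_sum big_geq// big_geq// burkholder0r.
have [n0|n0] := posnP n.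
  apply: avg_le0 => t; rewrite n0 /haar_sum !big_nat1 /= !mulr1 /b /c.
  by case: (A 0); [exact: burkholder0r|exact: burkholder0l].
have [L [j [nL jL _ _ step]]] := haar_step R n0.
rewrite (avg_indep (const_avg _ _ nK) (const_avg n.+1 L nL)) step.
rewrite -[leRHS]addr0 lerD ?IH ?(ltnW nL)//.
rewrite mulr_le0_ge0 ?invr_ge0 ?(ltW (pow2_gt0 L))// subr_le0 /b /c.
case: (A n); rewrite !(addr0, subr0).
  exact: burkholder_midpointl.
exact: burkholder_midpointr.
Qed.

(** Averaging [burkholder_majorization] and dropping the nonpositive Burkholder term bounds (p - 1)
    E|u|^p by C E|u + v|^p; the constant is a p-th root. *)
Lemma haar_suppression : exists C : R, forall a (A : pred nat) n,
  `|T (fun i => if A i then a i else 0) n| <= C * `|T a n|.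
Proof.
have [C C0 CP] := burkholder_majorization p_gt1.
have q0 : 0 < p - 1 by rewrite subr_gt0.
exists ((C / (p - 1)) `^ p^-1) => a A n.
have nK : (n <= 2 ^ n)%N by rewrite ltnW// ltn_expl.
rewrite -ler_powRp// ?mulr_ge0 ?powR_ge0// powRM ?powR_ge0// -powRrM mulVf ?gt_eqF//.
rewrite powRr1 ?divr_ge0 ?(ltW C0) ?(ltW q0)//.
rewrite mulrAC ler_pdivlMr// mulrC !(powR_norm_haar_sum p_gt1 _ nK).
have := burkholder_avg_le0 a A nK; rewrite -(lerD2r (C * avg n (fun t => `|haar_sum a n t| `^ p))).
rewrite add0r; apply: le_trans.
rewrite /avg !mulrA -mulrDl ler_pM2r ?invr_gt0// !mulr_sumr -big_split/=.
apply: ler_sum => j _; set t := grid _ _ _.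
have -> : haar_sum a n t = haar_sum (fun i => if A i then a i else 0) n t +
    haar_sum (fun i => if A i then 0 else a i) n t.
  rewrite /haar_sum -big_split/=; apply: eq_bigr => i _; rewrite -mulrDl.
  by case: (A i); rewrite ?addr0 ?add0r.
exact: CP.
Qed.

(* [h_n] takes each of the values [1] and [-1] with probability
   [`|h_n| `^ p / 2], so the two-point inequality, scaled by [`|h_n|], bounds
   the increment of the [p]-th power of the norm from below. *)
Lemma haar_increment : exists2 c : R, 0 < c & forall a n,
  `|T a n.+1| <= 1 ->
  c * (a n * `|H n|) ^+ 2 <= `|T a n.+1| `^ p - `|T a n| `^ p.
Proof.
have [c /andP[c0 c1] cP] := normr_powR_uniform_convexity p_gt1 p_le2.
exists c => // a n T1; have [n0|n0] := posnP n.
  (* The constant term is no two-point step: |a 0| <= 1, [p <= 2] and [c <= 1] give c |a 0|^2 <= |a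
     0|^p. *)
  move: T1; rewrite n0 big_nat1 big_geq// normr0 powR0 ?gt_eqF// subr0 normrZ.
  rewrite norm_haar0 !mulr1 => a1.
  apply: (@le_trans _ _ (`|a 0%N| ^+ 2)).
    by rewrite real_normK ?num_real// ler_piMl ?sqr_ge0.
  have [->|an0] := eqVneq `|a 0%N| 0; first by rewrite expr0n powR0 ?gt_eqF.
  by rewrite -powR_mulrn// ger_powR// a1 andbT lt_neqAle eq_sym an0/=.
have [K [HK /(_ a)[f [E fp fm]]]] := norm_haar_step n0.
have r0 := norm_haar_gt0 n; set r := `|H n| in HK r0 *.
have scale x : `|r * x| `^ p = 2 * (`|x| `^ p / 2 ^+ K).
  by rewrite normrM powRM// (gtr0_norm r0) HK; ring.
(* One half of the support carries at most the whole norm, so |r x|^p <= 2 <= 2^p; this is the range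
   needed for uniform convexity. *)
have le2 x : `|x| `^ p / 2 ^+ K <= `|T a n.+1| `^ p -> `|r * x| <= 2.
  move=> xT; rewrite -ler_powRp// scale.
  have xT1 : `|x| `^ p / 2 ^+ K <= 1.
    by rewrite (le_trans xT)// -[leRHS]one_powR ler_powRp.
  apply: (@le_trans _ _ (2 * 1)); first by rewrite ler_pM2l.
  by rewrite mulr1 le1r_powR ?ler1n// ltW.
have := cP (r * f) (a n * r); rewrite [a n * r]mulrC -mulrDr -mulrBr.
move=> /(_ (le2 _ fp) (le2 _ fm)); rewrite !scale E.
have -> : (`|f + a n| `^ p + `|f - a n| `^ p - 2 * `|f| `^ p) / 2 ^+ K =
  `|f + a n| `^ p / 2 ^+ K + `|f - a n| `^ p / 2 ^+ K - 2 * (`|f| `^ p / 2 ^+ K).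
  by ring.
by lra.
Qed.

End haar_unconditional.

Theorem proposition2p13 (R : realType) (p : R) (p_gt1 : 1 < p) (p_le2 : p <= 2) :
  unconditional_HS_basis (haar_basis (lee1_fin p_gt1)).
Proof.
set z := haar_basis _; pose H := haar_Lp (lee1_fin p_gt1).
have H0 i : 0 < `|H i| := norm_haar_gt0 p_gt1 i.
have zE a n : series (fun i => a i *: z i) n = \sum_(0 <= i < n) (a i / `|H i|) *: H i.
  by apply: eq_bigr => i _; rewrite /z /haar_basis scalerA.
have z_norm1 n : `|z n| = 1 by rewrite normrZV// unitfE gt_eqF.
have z_monotone a n : `|series (fun i => a i *: z i) n| <=
    `|series (fun i => a i *: z i) n.+1|.
  by rewrite !zE; exact: norm_haar_sum_le.
have z_dense x e : 0 < e -> exists a n, `|x - series (fun i => a i *: z i) n| < e.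
  move=> e0; have [a [n xa]] := haar_Lp_dense x e0.
  exists (fun i => a i * `|H i|), n; rewrite zE.
  by under eq_bigr do rewrite mulfK ?gt_eqF//.
split.
  have [c c0 cP] := haar_increment p_gt1 p_le2.
  apply: (@monotone_HS_basis _ _ _ z_norm1 z_monotone z_dense c^-1) => a n S1.
  (* The increments telescope; by monotonicity all partial sums up to [n] stay in the unit ball,
     where [haar_increment] applies. *)
  have incr m : (m <= n)%N -> c * \sum_(0 <= i < m) a i ^+ 2 <=
      `|series (fun i => a i *: z i) m| `^ p.
    elim: m => [|m IH] mn; first by rewrite big_geq// mulr0 powR_ge0.
    have := cP (fun i => a i / `|H i|) m.
    rewrite -!zE divfK ?gt_eqF// => /(_ (le_trans (partial_sum_le z_monotone a mn) S1)).
    by have := IH (ltnW mn); rewrite big_nat_recr//= mulrDr; lra.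
  rewrite -[c^-1]mulr1 ler_pdivlMl// (le_trans (incr n (leqnn n)))//.
  have q0 : 0 <= p by rewrite ltW// (lt_trans _ p_gt1).
  rewrite [leRHS](_ : 1 = 1 `^ p); last by rewrite powR1.
  by rewrite ge0_ler_powR ?nnegrE.
have [C CP] := haar_suppression p_gt1 p_le2.
apply: (@suppression_unconditional_basis _ _ _ C) => [|a A n].
  exact: monotone_schauder_basis.
have := CP (fun i => a i / `|H i|) A n; rewrite -zE; congr (`|_| <= _).
rewrite [RHS]big_mkcond; apply: eq_bigr => i _.
by rewrite /z /haar_basis scalerA; case: (A i); rewrite ?scale0r.
Qed.
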